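(* Let $k$ be a perfect field, let $\mathbf{E}\subset\{1,\dots,n\}$, and let $X\subset W=\mathbb{TA}^n_E$ be an affine toric embedding. Then there is a unique toric variety $V$ such that the embeddings $X\subset V\subset W$ are toric and $V$ is the minimum toric variety containing $X$ and transversal to $E$. That is, $V$ is transversal to $E$, and $V\subset V'$ for every toric variety $V'$ with toric embeddings $X\subset V'\subset W$ and $V'$ transversal to $E$.
   Context: For $\mathbf{E}\subset\{1,\dots,n\}$ set $\mathbb{TA}^n_E=\operatorname{Spec}\big(k[x_1,\dots,x_n]_{\prod_{i\notin\mathbf{E}}x_i}\big)$ (localization of the polynomial ring at the product of the $x_i$, $i\notin\mathbf{E}$); $E$ denotes the set of hypersurfaces $\{x_i=0\}$, $i\in\mathbf{E}$, of $\mathbb{TA}^n_E$. Let $\mathbb{T}^n=\operatorname{Spec}(k[x_1^{\pm1},\dots,x_n^{\pm1}])$. An affine toric variety is an affine variety $X$ (not necessarily normal) of dimension $d$ containing $\mathbb{T}^d$ as a dense open subset such that the action of the torus on itself extends to an action of $\mathbb{T}^d$ on $X$. An affine toric embedding $X\subset W$ is a reduced closed subscheme with $W$ a regular affine toric variety, $X$ an affine toric variety, and such that the inclusion is toric, i.e. gives a group homomorphism from the torus of $X$ to the torus of $W$. A subvariety $V\subset W$ is transversal to $E$ at a (closed) point $\xi\in V$ if there is a regular system of parameters $y_1,\dots,y_n$ of $\mathcal{O}_{W,\xi}$ such that $I(V)_\xi=(y_1,\dots,y_r)$ for some $r\le n$, and for every $H\in E$ with $\xi\in H$ one has $I(H)_\xi=(y_i)$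 for some $i$ with $r<i\le n$. $V$ is transversal to $E$ if it is so at every point of $V$. *)

(* Defs.v *)
From HB Require Import structures.
From mathcomp Require Import all_boot all_order all_algebra all_field.
From mathcomp Require Import finmap.
From mathcomp.multinomials Require Import monalg.

Set Implicit Arguments.
Unset Strict Implicit.
Unset Printing Implicit Defensive.

Import Order.TTheory GRing.Theory Num.Theory.
Local Open Scope fset_scope.
Local Open Scope ring_scope.

(* The Laurent polynomial ring R[t_1^{+-1}, ..., t_d^{+-1}], as the group     *)
(* algebra of Z^d: lterm c m is the term c t^m, and p@_m the coefficient of   *)
(* t^m in p.  (The product of monalg needs monomials without units.)          *)
Definition laurent (R : comNzRingType) (d : nat) : Type :=
  {malg R['rV[int]_d]}.

HB.instance Definition _ (R : comNzRingType) (d : nat) :=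
  GRing.Lmodule.copy (laurent R d) {malg R['rV[int]_d]}.

HB.lock Definition lterm (R : comNzRingType) (d : nat)
    (c : R) (m : 'rV[int]_d) : laurent R d := << c *g m >>.

HB.lock Definition lmul (R : comNzRingType) (d : nat)
    (p q : laurent R d) : laurent R d :=
  \sum_(a <- msupp p) \sum_(b <- msupp q) lterm (p@_a * q@_b) (a + b).

Section LaurentRing.
Variables (R : comNzRingType) (d : nat).
Local Notation M := 'rV[int]_d.
Local Notation L := (laurent R d).
Local Notation lmul := (@lmul R d).

Implicit Types (p q r : L) (a b m : M) (c x y z : R).

Lemma mcoeff_lterm c a m : (lterm c a)@_m = c *+ (a == m).
Proof. by rewrite lterm.unlock mcoeffU. Qed.

Lemma mcoeff_lscale c p m : (c *: p)@_m = c * p@_m.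
Proof. exact: mcoeffZ. Qed.

Lemma lterm0 a : lterm 0 a = 0 :> L.
Proof. by rewrite lterm.unlock monalgU0. Qed.

Lemma ltermD c c' a : lterm (c + c') a = lterm c a + lterm c' a :> L.
Proof. by rewrite lterm.unlock monalgUD. Qed.

Lemma lterm_eq0 c a : (lterm c a == 0 :> L) = (c == 0).
Proof. by rewrite lterm.unlock monalgU_eq0. Qed.

Lemma msupp_lterm_le c a : msupp (lterm c a) `<=` [fset a].
Proof. by rewrite lterm.unlock msuppU_le. Qed.

Lemma laurentE p : p = \sum_(a <- msupp p) lterm p@_a a.
Proof. by rewrite lterm.unlock; apply: monalgE. Qed.

Lemma laurent_ind (P : L -> Prop) :
  (forall p q, P p -> P q -> P (p + q)) -> (forall c m, P (lterm c m)) ->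
  forall p, P p.
Proof.
move=> PD PU p; rewrite [p]laurentE; elim/big_ind: _ => //.
by rewrite -(lterm0 0).
Qed.

Lemma lmulEw (A B : {fset M}) p q :
  msupp p `<=` A -> msupp q `<=` B ->
  lmul p q = \sum_(a <- A) \sum_(b <- B) lterm (p@_a * q@_b) (a + b).
Proof.
move=> sA sB; rewrite lmul.unlock (big_fset_incl _ sA) /=; last first.
  move=> a _ /mcoeff_outdom a0; rewrite big1 // => b _.
  by rewrite a0 mul0r lterm0.
apply: eq_bigr => a _; apply: (big_fset_incl _ sB) => b _ /mcoeff_outdom b0.
by rewrite b0 mulr0 lterm0.
Qed.

Lemma lmulC : commutative lmul.
Proof.
move=> p q; rewrite lmul.unlock exchange_big; apply: eq_bigr => a _.
by apply: eq_bigr => b _; rewrite mulrC addrC.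
Qed.

Lemma lmulDl : left_distributive lmul +%R.
Proof.
move=> p q r; pose A := msupp p `|` msupp q.
rewrite (@lmulEw A (msupp r) (p + q) r) //; last exact: msuppD_le.
rewrite (@lmulEw A (msupp r) p r) ?fsubsetUl //.
rewrite (@lmulEw A (msupp r) q r) ?fsubsetUr //.
rewrite -big_split; apply: eq_bigr => a _; rewrite -big_split /=.
by apply: eq_bigr => b _; rewrite mcoeffD mulrDl ltermD.
Qed.

Lemma lmulDr : right_distributive lmul +%R.
Proof. by move=> p q r; rewrite !(lmulC p) lmulDl. Qed.

Lemma lmulUU x y a b : lmul (lterm x a) (lterm y b) = lterm (x * y) (a + b).
Proof.
rewrite (lmulEw (msupp_lterm_le x a) (msupp_lterm_le y b)).
by rewrite !big_seq_fset1 !mcoeff_lterm !eqxx.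
Qed.

Lemma lmulA : associative lmul.
Proof.
move=> p q r; elim/laurent_ind: p => [p p' IHp IHp'|x a].
  by rewrite !lmulDl IHp IHp'.
elim/laurent_ind: q => [q q' IHq IHq'|y b].
  by rewrite lmulDr !lmulDl lmulDr IHq IHq'.
elim/laurent_ind: r => [r r' IHr IHr'|z e].
  by rewrite !lmulDr IHr IHr'.
by rewrite !lmulUU mulrA addrA.
Qed.

Lemma lmul1p : left_id (lterm 1 0) lmul.
Proof.
move=> p; elim/laurent_ind: p => [p q IHp IHq|x a].
  by rewrite lmulDr IHp IHq.
by rewrite lmulUU mul1r add0r.
Qed.

Lemma lterm1_neq0 : lterm 1 0 != 0 :> L.
Proof. by rewrite lterm_eq0 oner_eq0. Qed.

HB.instance Definition _ := GRing.Zmodule_isComNzRing.Build L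
  lmulA lmulC lmul1p lmulDl lterm1_neq0.

Lemma laurent1E : 1 = lterm 1 0 :> L.
Proof. by []. Qed.

Lemma ltermM x y a b : lterm x a * lterm y b = lterm (x * y) (a + b) :> L.
Proof. exact: lmulUU. Qed.

Lemma lscaleU c x a : c *: lterm x a = lterm (c * x) a :> L.
Proof. by apply/malgP => m; rewrite mcoeff_lscale !mcoeff_lterm mulrnAr. Qed.

Lemma lscaleAl c p q : c *: (p * q) = (c *: p) * q.
Proof.
elim/laurent_ind: p => [p p' IHp IHp'|x a].
  by rewrite mulrDl !scalerDr mulrDl IHp IHp'.
elim/laurent_ind: q => [q q' IHq IHq'|y b].
  by rewrite !mulrDr scalerDr IHq IHq'.
by rewrite lscaleU !ltermM lscaleU mulrA.
Qed.

HB.instance Definition _ := GRing.Lmodule_isLalgebra.Build R L lscaleAl.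
HB.instance Definition _ := GRing.Lalgebra_isComAlgebra.Build R L.

End LaurentRing.

(* The coordinate ring k[x_1, ..., x_n]_{prod_(i \notin E) x_i} of TA^n_E,    *)
(* inside that of T^n: exponents of x_i are nonnegative for i \in E, and      *)
(* arbitrary for i \notin E; see taffine_localization.                        *)
Definition taffine_pred (R : comNzRingType) (n : nat) (E : {set 'I_n}) :
    {pred laurent R n} :=
  fun p => all (fun m : 'rV[int]_n => [forall i in E, 0 <= m 0 i]) (msupp p).

Section TAffineClosed.
Variables (R : comNzRingType) (n : nat) (E : {set 'I_n}).
Local Notation P := (@taffine_pred R n E).

Lemma taffine_predP (p : laurent R n) :
  reflect (forall m, m \in msupp p -> forall i, i \in E -> 0 <= m 0 i)
          (p \in P).
Proof.
apply: (iffP allP) => [h m /h /forall_inP //|h m /h hm]; exact/forall_inP.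
Qed.

Lemma taffine_pred_lterm c (m : 'rV[int]_n) :
  (forall i, i \in E -> 0 <= m 0 i) -> lterm c m \in P.
Proof.
move=> hm; apply/taffine_predP => m' /(fsubsetP (msupp_lterm_le _ _)).
by rewrite in_fset1 => /eqP ->.
Qed.

Lemma taffine_subalg_closed : subalg_closed P.
Proof.
split=> [|c p q hp hq|p q hp hq].
- by rewrite laurent1E taffine_pred_lterm // => i _; rewrite mxE.
- apply/taffine_predP => m /(fsubsetP (msuppD_le _ _)); rewrite in_fsetU.
  case/orP => [/(fsubsetP (msuppZ_le _ _))|]; exact/taffine_predP.
have PD p' q' : p' \in P -> q' \in P -> p' + q' \in P.
  move=> hp' hq'; apply/taffine_predP => m /(fsubsetP (msuppD_le _ _)).
  by rewrite in_fsetU => /orP []; apply/taffine_predP.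
have P0 : 0 \in P by apply/taffine_predP => m; rewrite msupp0.
have PS (s : seq 'rV[int]_n) F :
    (forall m, m \in s -> F m \in P) -> \sum_(m <- s) F m \in P.
  elim: s => [|m s IHs] hF; first by rewrite big_nil.
  rewrite big_cons PD ?hF ?mem_head // IHs // => m' m's.
  by rewrite hF // inE m's orbT.
have -> : p * q = \sum_(a <- msupp p) \sum_(b <- msupp q)
    lterm (p@_a * q@_b) (a + b).
  by rewrite /GRing.mul /= lmul.unlock.
apply: (PS) => a ap; apply: (PS) => b bq; apply: taffine_pred_lterm => i iE.
by rewrite mxE addr_ge0 //;
  [exact: (elimT (taffine_predP p) hp)
  | exact: (elimT (taffine_predP q) hq)].
Qed.

HB.instance Definition _ :=
  GRing.isSubalgClosed.Build R (laurent R n) P taffine_subalg_closed.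

End TAffineClosed.

Record taffine (R : comNzRingType) (n : nat) (E : {set 'I_n}) : Type :=
  TAffine {taffine_val :> laurent R n; taffine_valP : taffine_val \in taffine_pred E}.

Section TAffineAlg.
Variables (R : comNzRingType) (n : nat) (E : {set 'I_n}).

HB.instance Definition _ := [isSub for @taffine_val R n E].
HB.instance Definition _ := [Choice of taffine R E by <:].
HB.instance Definition _ :=
  [SubChoice_isSubAlgebra of taffine R E by <:].
HB.instance Definition _ :=
  [SubNzRing_isSubComNzRing of taffine R E by <:].

Lemma taffine_val_linear : linear (@taffine_val R n E).
Proof. by []. Qed.

Lemma taffine_val_monoid : monoid_morphism (@taffine_val R n E).
Proof. by []. Qed.

HB.instance Definition _ := GRing.isLinear.Build R (taffine R E) (laurent R n)
  *:%R (@taffine_val R n E) taffine_val_linear.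
HB.instance Definition _ := GRing.isMonoidMorphism.Build (taffine R E)
  (laurent R n) (@taffine_val R n E) taffine_val_monoid.
End TAffineAlg.

Definition lvar (R : comNzRingType) (n : nat) (i : 'I_n) : laurent R n :=
  lterm 1 (delta_mx 0 i).

Section TAffineLocalization.
Variables (R : comNzRingType) (n : nat) (E : {set 'I_n}).

Lemma prod_lvarX (N : nat) :
  (\prod_(i | i \notin E) lvar R i) ^+ N
  = lterm 1 (\row_i (if i \in E then 0 else N%:Z)).
Proof.
have -> : \prod_(i | i \notin E) lvar R i
    = lterm 1 (\sum_(i | i \notin E) delta_mx 0 i).
  pose K (x : laurent R n) (m : 'rV[int]_n) := x = lterm 1 m.
  apply: (big_rec2 K) => // i m x _ ->.
  by rewrite /K /lvar ltermM mulr1.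
have -> : \row_i (if i \in E then 0 else N%:Z)
    = (\sum_(i | i \notin E) delta_mx 0 i) *+ N :> 'rV[int]_n.
  apply/rowP => i; rewrite mxE mulmxnE summxE.
  have [iE|iE] := boolP (i \in E).
    rewrite big1 ?mul0rn // => j jE; rewrite mxE /=.
    by case: eqP jE => // <-; rewrite iE.
  rewrite (bigD1 i) //= big1 => [|j /andP[_ ji]].
    rewrite mxE !eqxx addr0 /=. exact/esym/natz.
  by rewrite mxE /= eq_sym (negbTE ji).
elim: N => [|N IHN]; first by rewrite expr0 mulr0n laurent1E.
by rewrite exprS IHN ltermM mulr1 mulrS.
Qed.

Lemma mcoeffM_lterm (p : laurent R n) (w m : 'rV[int]_n) :
  (p * lterm 1 w)@_m = p@_(m - w).
Proof.
elim/laurent_ind: p => [p q IHp IHq|c a].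
  by rewrite mulrDl !mcoeffD IHp IHq.
by rewrite ltermM !mcoeff_lterm mulr1 eq_sym -subr_eq eq_sym.
Qed.

Lemma taffine_localization (p : laurent R n) :
  p \in taffine_pred E <->
  exists N, p * (\prod_(i | i \notin E) lvar R i) ^+ N
    \in taffine_pred [set: 'I_n].
Proof.
split=> [/taffine_predP hp|[N]]; last first.
  rewrite prod_lvarX => /taffine_predP hp; apply/taffine_predP => m mp i iE.
  set w := \row_i _ in hp.
  have /hp/(_ i (in_setT i)) : m + w \in msupp (p * lterm 1 w).
    by rewrite -mcoeff_neq0 mcoeffM_lterm addrK mcoeff_neq0.
  by rewrite !mxE iE addr0.
pose N := (\sum_(m <- msupp p) \sum_i `|m 0%R i|)%N.
exists N; rewrite prod_lvarX; apply/taffine_predP => m.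
rewrite -mcoeff_neq0 mcoeffM_lterm mcoeff_neq0; set m' := m - _ => mp i _.
have mE : m 0 i = m' 0 i + (if i \in E then 0 else N%:Z).
  by rewrite !mxE subrK.
rewrite mE; have [iE|_] := boolP (i \in E).
  by rewrite addr0; apply: hp.
have le1 : (`|m' 0%R i| <= N)%N.
  rewrite /N (big_fsetD1 _ mp) /= (bigD1 i) //= -addnA.
  exact: leq_addr.
rewrite -lerBlDr sub0r lerNl; apply: le_trans (ler_norm _) _.
by rewrite normrN -abszE lez_nat.
Qed.

End TAffineLocalization.

Definition lmap (R S : comNzRingType) (d : nat) (g : R -> S)
    (p : laurent R d) : laurent S d :=
  \sum_(m <- msupp p) lterm (g p@_m) m.

(* Multiplication T^d x T^d -> T^d of the torus over R, as t^m |-> s^m t^m;   *)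
(* A[T^d x T^d] is presented as Laurent polynomials over Laurent polynomials. *)
Definition comul (R : comNzRingType) (d : nat) (p : laurent R d) :
    laurent (laurent R d) d :=
  \sum_(m <- msupp p) lterm (lterm p@_m m) m.

(* Evaluation at the unit element of the torus. *)
Definition counit (R : comNzRingType) (d : nat) (p : laurent R d) : R :=
  \sum_(m <- msupp p) p@_m.

(* The tensor product A (x) k[T^e] -> B (x) k[T^d] of f and phi. *)
Definition ltensor (k : fieldType) (A B : comAlgType k) (d e : nat)
    (f : A -> B) (phi : laurent k e -> laurent k d) (p : laurent A e) :
    laurent B d :=
  \sum_(m <- msupp p) lmap (fun c : k => c *: f p@_m) (phi (lterm 1 m)).

(* phi is the comorphism of a homomorphism of group schemes T^d -> T^e. *)
Definition torus_hom (k : fieldType) (d e : nat)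
    (phi : {lrmorphism laurent k e -> laurent k d}) : Prop :=
  forall p, comul (phi p) = ltensor phi phi (comul p).

Definition surjective_fun (A B : Type) (f : A -> B) : Prop :=
  forall b, exists a, f a = b.

(* The localization A_s -> B_(f s) of f is bijective. *)
Definition iso_over_principal_open (A B : comNzRingType)
    (f : {rmorphism A -> B}) (s : A) : Prop :=
  (forall a N, f (s ^+ N * a) = 0 -> exists N', s ^+ N' * a = 0) /\
  (forall b, exists a N, f s ^+ N * b = f a).

(* Spec B -> Spec A is an isomorphism onto an open subscheme: some principal  *)
(* opens D(s_i) of Spec A contain its image (their inverse images cover       *)
(* Spec B), and it is an isomorphism over each of them.                       *)
Definition open_immersion (A B : comNzRingType) (f : {rmorphism A -> B}) :
    Prop :=
  exists (r : nat) (s : 'I_r -> A),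
    (exists c : 'I_r -> B, \sum_i c i * f (s i) = 1) /\
    (forall i, iso_over_principal_open f (s i)).

(* Every nonempty principal open D(a) meets the image of Spec B -> Spec A. *)
Definition dense_image (A B : comNzRingType) (f : {rmorphism A -> B}) : Prop :=
  forall a, (exists N, f a ^+ N = 0) -> exists N, a ^+ N = 0.

(* A is the coordinate ring of an affine variety: an integral domain of       *)
(* finite type over k; taffine k setT is k[x_1, ..., x_r].                    *)
Definition affine_variety (k : fieldType) (A : comAlgType k) : Prop :=
  (forall a b : A, a * b = 0 -> a = 0 \/ b = 0) /\
  (exists (r : nat) (g : {lrmorphism taffine k [set: 'I_r] -> A}),
    surjective_fun g).

(* sigma : A -> A (x) k[T^d] is the coaction of an action of T^d on Spec A    *)
(* which restricts, along j : A -> k[T^d], to the multiplication of T^d.      *)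
Record torus_coaction (k : fieldType) (A : comAlgType k) (d : nat)
    (j : {lrmorphism A -> laurent k d})
    (sigma : {rmorphism A -> laurent A d}) : Prop := {
  coaction_scale : forall (c : k) a, sigma (c *: a) = c%:A *: sigma a;
  coaction_counit : forall a, counit (sigma a) = a;
  coaction_comul : forall a, lmap sigma (sigma a) = comul (sigma a);
  coaction_extends : forall a, lmap j (sigma a) = comul (j a)
}.

(* An affine toric variety X = Spec A, with its torus T^d -> X. *)
Record toric_variety (k : fieldType) := ToricVariety {
  coord_ring :> comAlgType k;
  torus_dim : nat;
  torus_incl : {lrmorphism coord_ring -> laurent k torus_dim};
  toric_is_variety : affine_variety coord_ring;
  torus_open : open_immersion torus_incl;
  torus_dense : dense_image torus_incl;
  torus_action :
    exists sigma : {rmorphism coord_ring -> laurent coord_ring torus_dim},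
      torus_coaction torus_incl sigma
}.

(* f : B -> A defines a closed immersion Spec A -> Spec B which restricts to  *)
(* a group homomorphism from the torus jA of Spec A to the torus jB of Spec B *)
Record toric_embedding (k : fieldType) (A B : comAlgType k) (d e : nat)
    (jA : {lrmorphism A -> laurent k d}) (jB : {lrmorphism B -> laurent k e})
    (f : {lrmorphism B -> A}) : Prop := {
  toric_embedding_closed : surjective_fun f;
  toric_embedding_torus :
    exists phi : {lrmorphism laurent k e -> laurent k d},
      (forall b, phi (jB b) = jA (f b)) /\ torus_hom phi
}.

Section Transversality.
Variable R : comNzRingType.
Implicit Types (I J : R -> Prop).

Definition is_ideal I : Prop :=
  [/\ I 0, forall a b, I a -> I b -> I (a + b) & forall c a, I a -> I (c * a)].

Definition maximal_ideal I : Prop :=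
  [/\ is_ideal I, ~ I 1 &
    forall J, is_ideal J -> (forall a, I a -> J a) ->
      J 1 \/ (forall a, J a -> I a)].

Definition ideal_span (S : R -> Prop) : R -> Prop :=
  fun x => exists (r : nat) (c s : 'I_r -> R),
    (forall i, S (s i)) /\ x = \sum_i c i * s i.

Definition same_ideal I J : Prop := forall x, I x <-> J x.

Definition invertible (x : R) : Prop := exists y, x * y = 1.

End Transversality.

(* l : R -> O is the localization of R at the complement of the prime M. *)
Record is_localization_at (R O : comNzRingType) (M : R -> Prop)
    (l : {rmorphism R -> O}) : Prop := {
  localization_unit : forall s, ~ M s -> invertible (l s);
  localization_frac : forall x, exists a s, ~ M s /\ x * l s = l a;
  localization_eq0 : forall a, l a = 0 -> exists s, ~ M s /\ s * a = 0
}.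

(* I O, the localization of the ideal I. *)
Definition localized_ideal (R O : comNzRingType) (l : {rmorphism R -> O})
    (I : R -> Prop) : O -> Prop :=
  ideal_span (fun y => exists2 a, I a & y = l a).

(* y is a regular system of parameters of the n-dimensional regular local     *)
(* ring O: n generators of the maximal ideal, i.e. of the nonunits.           *)
Definition regular_system_of_parameters (O : comNzRingType) (n : nat)
    (y : 'I_n -> O) : Prop :=
  same_ideal (ideal_span (fun z => exists i, z = y i))
             (fun z => ~ invertible z).

(* W = Spec R is regular of dimension n at all its closed points, M is the    *)
(* maximal ideal of a closed point xi, J the ideal of V, and h i, for i \in E,*)
(* the equation of a hypersurface of W.  The indices are shifted by one:      *)
(* y_1, ..., y_r are the y i with i < r.                                      *)
Definition transversal_at (R : comNzRingType) (n : nat) (E : {set 'I_n})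
    (h : 'I_n -> R) (J M : R -> Prop) : Prop :=
  exists (O : comNzRingType) (l : {rmorphism R -> O}),
    is_localization_at M l /\
    exists (y : 'I_n -> O) (r : nat),
      [/\ (r <= n)%N,
          regular_system_of_parameters y,
          same_ideal (localized_ideal l J)
            (ideal_span (fun z => exists2 i : 'I_n, (i < r)%N & z = y i)) &
          forall i, i \in E -> M (h i) ->
            exists2 j : 'I_n, (r <= j)%N &
              same_ideal
                (localized_ideal l (ideal_span (fun x => x = h i)))
                (ideal_span (fun z => z = y j))].

Definition transversal (R : comNzRingType) (n : nat) (E : {set 'I_n})
    (h : 'I_n -> R) (J : R -> Prop) : Prop :=
  forall M : R -> Prop, maximal_ideal M -> (forall a, J a -> M a) ->
    transversal_at E h J M.

Lemma taffine_var_proof (R : comNzRingType) (n : nat) (E : {set 'I_n})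
  (i : 'I_n) : lvar R i \in taffine_pred E.
Proof.
by apply: taffine_pred_lterm => j _; rewrite mxE; case: (_ && _).
Qed.

Definition taffine_var (R : comNzRingType) (n : nat) (E : {set 'I_n})
  (i : 'I_n) : taffine R E := TAffine (taffine_var_proof R E i).

(* The ideal of the closed subscheme Spec A of Spec B. *)
Definition ideal_of (A B : comNzRingType) (f : {rmorphism B -> A}) : B -> Prop :=
  fun b => f b = 0.

Section MinimalToric.
Variables (k : fieldType) (n : nat) (E : {set 'I_n}).
Local Notation W := (taffine k E).
Implicit Types (X V : toric_variety k).

(* The torus of TA^n_E is T^n, by the localization k[TA^n_E] -> k[T^n]. *)
Definition toric_in_TA V (iV : {lrmorphism W -> V}) : Prop :=
  toric_embedding (torus_incl V) (@taffine_val k n E) iV.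

(* X is contained in V and V in W, by toric embeddings. *)
Definition toric_between X (iX : {lrmorphism W -> X})
    V (iV : {lrmorphism W -> V}) : Prop :=
  toric_in_TA iV /\
  exists f : {lrmorphism V -> X},
    (forall w, f (iV w) = iX w) /\
    toric_embedding (torus_incl X) (torus_incl V) f.

Definition transversal_to_E V (iV : {lrmorphism W -> V}) : Prop :=
  transversal E (taffine_var k E) (ideal_of iV).

Definition minimum_transversal X (iX : {lrmorphism W -> X})
    V (iV : {lrmorphism W -> V}) : Prop :=
  [/\ toric_between iX iV,
      transversal_to_E iV &
      forall V' (iV' : {lrmorphism W -> V'}),
        toric_between iX iV' -> transversal_to_E iV' ->
        forall w, ideal_of iV' w -> ideal_of iV w].

End MinimalToric.

Definition perfect_field (k : fieldType) : Prop :=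
  forall p : {poly k}, irreducible_poly p -> separable_poly p.

(* Main.v *)
Require Import Defs.
From HB Require Import structures.
From mathcomp Require Import all_boot all_order all_algebra all_field.
From mathcomp Require Import finmap zify ring boolp.
From mathcomp.multinomials Require Import monalg.

Set Implicit Arguments.
Unset Strict Implicit.
Unset Printing Implicit Defensive.

Import Order.TTheory GRing.Theory Num.Theory.
Local Open Scope ring_scope.

(* The toric subvarieties of TA^n_E are the closures of the subtori           *)
(* {t | t^a = 1 for a in L}, with L a saturated lattice in Z^n.  The sets of  *)
(* coordinates in E that vanish at some point of the closure are the faces of *)
(* L: the sets G such that no a in L is nonnegative and nonzero on G.  Such a *)
(* closure is transversal to E at a point with face G iff L vanishes on G.    *)
(* Faces are stable under union, so X has a largest face F, and the minimum V *)
(* is given by the a in L_X that vanish on F; its faces are contained in F.   *)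
(* V is transversal: completing a basis of L_V and the unit vectors of F to a *)
(* basis of Z^n gives n monomials z_j generating the local ring of W up to    *)
(* units; V is z_j = 1 for j < r, and one parameter for each z_j generates    *)
(* the maximal ideal.                                                         *)
(* Conversely, let V' be transversal at the point x_i = 0 (i in F), x_i = 1   *)
(* (i not in F).  The part of an equation of V' whose monomials involve F has *)
(* its gradient in the span of the x_i (i in F), so transversality puts it in *)
(* m I(V').  On a curve x_i = t^(w_i) (i in F), x_i = 1 (i not in F), the     *)
(* other part vanishes, so the equations of V' vanish to infinite order, and  *)
(* the binomials x^u - x^v in I(V') give w.(u - v) = 0 on F for all w > 0.    *)

(** * Laurent polynomials *)

(** The problem is one about lattices. By [torus_hom_matrix], a toric embedding in W is given by an
    integer matrix A, through x^m -> t^(mA); its ideal is the kernel of [lmon A]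
    ([toric_in_TA_lmon]). Inclusion of such ideals amounts to inclusion of the lattices of all a
    with aA = 0 ([exponent_kernel_sub], [lmon_kernel_sub]). So V is sought among the sublattices of
    L_X, a larger lattice meaning a smaller variety.

    Let F be the largest face of X ([maximum_face]). If V' contains X, then F is also a face of V',
    and transversality at the corresponding point forces the lattice of V' to vanish on F
    ([transversal_vanish]). Hence that lattice lies in the lattice of all a in L_X that vanish on F.
    The variety V of the latter is the minimum as soon as it is transversal.

    To see that it is, [adapted_basis] provides a basis of Z^n containing a basis of this lattice
    and the unit vectors of F. At a closed point of V the vanishing coordinates of E form a face of
    V ([vanishing_face]), hence lie in F. Up to units, the local ring is that of k[z_1, ..., z_n]
    for the basis monomials z_j; V is z_j = 1 for j < r, and the hypersurfaces through the point are
    z_j = 0 for some j >= r. The residue field may be larger than k, so the other parameters need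
    not be of the form z_j - c; [tower_parameters] adjoins the z_j one at a time and picks one
    parameter for each ([subtorus_transversal_at]).

    For [transversal_vanish], [transversal_moving] compares gradients at the point to put the part
    of an equation that involves F into m I(V') locally. [curve_ideal] then restricts to monomial
    curves through the point, where the equations vanish to every order, and binomial equations
    yield the linear conditions on the lattice. *)

Section CoefficientSums.
Variables (R : comNzRingType) (d : nat).
Local Notation M := 'rV[int]_d.
Implicit Types (p q : laurent R d).

Lemma laurent_supp_ind (Q : M -> Prop) (P : laurent R d -> Prop) :
  P 0 -> (forall p q, P p -> P q -> P (p + q)) ->
  (forall c m, Q m -> P (lterm c m)) ->
  forall p, (forall m, m \in msupp p -> Q m) -> P p.
Proof.
move=> P0 PD PU p hp; rewrite [p]laurentE big_seq.
by elim/big_ind: _ => // m mp; apply/PU/hp.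
Qed.

Section Additive.
Variables (Z : zmodType) (F : M -> R -> Z).
Hypothesis FD : forall m, {morph F m : x y / x + y}.

(** [comul], [counit], [lmap], [leval] and [ltensor] are all of this shape. The support changes
    under addition, so additivity is proved once, by enlarging the index set to the union of the
    supports. *)
Definition csum p : Z := \sum_(m <- msupp p) F m p@_m.

Let F0 m : F m 0 = 0.
Proof. by apply: (@addrI _ (F m 0)); rewrite -FD !addr0. Qed.

Let csumEw (A : {fset M}) p :
  (msupp p `<=` A)%fset -> csum p = \sum_(m <- A) F m p@_m.
Proof.
move=> sA; apply: (big_fset_incl _ sA) => m _ /mcoeff_outdom ->; exact: F0.
Qed.

Lemma csumD : {morph csum : p q / p + q}.
Proof.
move=> p q; pose A := (msupp p `|` msupp q)%fset.
rewrite (@csumEw A (p + q)) ?msuppD_le // (@csumEw A p) ?fsubsetUl //.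
rewrite (@csumEw A q) ?fsubsetUr // -big_split /=.
by apply: eq_bigr => m _; rewrite mcoeffD FD.
Qed.

Lemma csum_lterm c m : csum (lterm c m) = F m c.
Proof.
rewrite (csumEw (msupp_lterm_le c m)) big_seq_fset1.
by rewrite mcoeff_lterm eqxx.
Qed.

Lemma csum0 : csum 0 = 0.
Proof. by apply: (@addrI _ (csum 0)); rewrite -csumD !addr0. Qed.
End Additive.

Lemma comulD : {morph @comul R d : p q / p + q}.
Proof.
apply: (csumD (F := fun m (c : R) => lterm (lterm c m : laurent R d) m)).
by move=> m x y; rewrite !ltermD.
Qed.
Lemma comul_lterm c (m : M) : comul (lterm c m) = lterm (lterm c m : laurent R d) m.
Proof.
apply: (csum_lterm (F := fun m (c : R) => lterm (lterm c m : laurent R d) m)).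
by move=> ? x y; rewrite !ltermD.
Qed.
Lemma comul0 : comul (0 : laurent R d) = 0.
Proof. by rewrite /comul msupp0 big_seq_fset0. Qed.

Lemma counitD : {morph @counit R d : p q / p + q}.
Proof. exact: (csumD (F := fun _ c => c)). Qed.
Lemma counit_lterm c (m : M) : counit (lterm c m : laurent R d) = c.
Proof. exact: (csum_lterm (F := fun _ c => c)). Qed.
Section Map.
Variables (S : comNzRingType) (g : R -> S).
Hypothesis gD : {morph g : x y / x + y}.
Lemma lmapD : {morph @lmap R S d g : p q / p + q}.
Proof.
by apply: (csumD (F := fun m c => lterm (g c) m)) => m x y; rewrite gD ltermD.
Qed.
Lemma lmap_lterm c (m : M) : lmap g (lterm c m) = lterm (g c) m.
Proof.
by apply: (csum_lterm (F := fun m c => lterm (g c) m)) => ? x y; rewrite gD ltermD.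
Qed.
Lemma mcoeff_lmap p (m : M) : (lmap g p)@_m = g p@_m.
Proof.
have g0 : g 0 = 0 by apply: (@addrI _ (g 0)); rewrite -gD !addr0.
elim/laurent_ind: p => [p q IHp IHq|c a].
  by rewrite lmapD !mcoeffD IHp IHq gD.
by rewrite lmap_lterm !mcoeff_lterm; case: eqP.
Qed.
End Map.
Section Eval.
Variables (S : comNzRingType) (h : {rmorphism R -> S}) (u : M -> S).

Definition leval p : S := \sum_(m <- msupp p) h p@_m * u m.

Let FD m : {morph (fun c => h c * u m) : x y / x + y}.
Proof. by move=> x y; rewrite rmorphD mulrDl. Qed.

Lemma levalD : {morph leval : p q / p + q}.
Proof. exact: (csumD FD). Qed.
Lemma leval_lterm c m : leval (lterm c m) = h c * u m.
Proof. exact: (csum_lterm (F := fun m c => h c * u m)). Qed.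
Lemma leval0 : leval 0 = 0.
Proof. exact: (csum0 FD). Qed.
Lemma levalN : {morph leval : p / - p}.
Proof. by move=> p; apply: (@addrI _ (leval p)); rewrite -levalD !subrr leval0. Qed.
Lemma levalB : {morph leval : p q / p - q}.
Proof. by move=> p q; rewrite levalD levalN. Qed.

Lemma levalZ c p : leval (c *: p) = h c * leval p.
Proof.
elim/laurent_ind: p => [p q IHp IHq|x a].
  rewrite [leval (p + q)]levalD mulrDr -IHp -IHq -levalD.
  congr leval; exact: scalerDr.
by rewrite lscaleU !leval_lterm rmorphM mulrA.
Qed.

(** Multiplicativity of [u] is asked only on the exponents in [Q]. On W this admits monoid maps,
    such as evaluation at a point with zero coordinates, that do not extend to Z^n. *)
Lemma levalM (Q : M -> Prop) :
  (forall a b, Q a -> Q b -> u (a + b) = u a * u b) ->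
  forall p q, (forall m, m \in msupp p -> Q m) ->
  (forall m, m \in msupp q -> Q m) -> leval (p * q) = leval p * leval q.
Proof.
move=> uM p q hp hq; move: p hp.
apply: laurent_supp_ind => [|p p' IHp IHp'|x a Qa].
- by rewrite mul0r leval0 mul0r.
- by rewrite mulrDl !levalD IHp IHp' mulrDl.
move: q hq; apply: laurent_supp_ind => [|q q' IHq IHq'|y b Qb].
- by rewrite mulr0 leval0 mulr0.
- by rewrite mulrDr !levalD IHq IHq' mulrDr.
by rewrite ltermM !leval_lterm rmorphM uM // mulrACA.
Qed.

Lemma leval1 : u 0 = 1 -> leval 1 = 1.
Proof. by move=> u1; rewrite laurent1E leval_lterm u1 rmorph1 mulr1. Qed.
End Eval.
End CoefficientSums.

Lemma laurent_addr_ext (R : comNzRingType) (d : nat) (Z : zmodType)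
    (f g : laurent R d -> Z) :
  {morph f : p q / p + q} -> {morph g : p q / p + q} ->
  (forall c m, f (lterm c m) = g (lterm c m)) -> f =1 g.
Proof.
move=> fD gD fg; elim/laurent_ind => [p q IHp IHq|//].
by rewrite fD gD IHp IHq.
Qed.

Lemma lterm1_inj (R : comNzRingType) (d : nat) :
  injective (lterm (1 : R) : 'rV[int]_d -> laurent R d).
Proof.
move=> a b ab; have := congr1 (mcoeff b) ab; rewrite !mcoeff_lterm eqxx.
by case: eqP => // _ /esym/eqP; rewrite (negbTE (oner_neq0 _)).
Qed.

Section Tensor.
Variables (k : fieldType) (A B : comAlgType k) (d e : nat).
Variables (f : {additive A -> B}) (phi : laurent k e -> laurent k d).
Lemma ltensor_lterm c m : ltensor f phi (lterm c m)
  = lmap (fun x : k => x *: f c) (phi (lterm 1 m)).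
Proof.
apply: (csum_lterm (F := fun m c =>
  lmap (fun x : k => x *: f c) (phi (lterm 1 m)))) => {}m x y.
apply/malgP => b.
have gD (z : B) : {morph (fun t : k => t *: z) : x y / x + y}.
  by move=> s t; rewrite scalerDl.
by rewrite mcoeffD !mcoeff_lmap // raddfD scalerDr.
Qed.
Lemma ltensorD : {morph ltensor f phi : p q / p + q}.
Proof.
apply: (csumD (F := fun m c =>
  lmap (fun x : k => x *: f c) (phi (lterm 1 m)))) => {}m x y.
apply/malgP => b.
have gD (z : B) : {morph (fun t : k => t *: z) : x y / x + y}.
  by move=> s t; rewrite scalerDl.
by rewrite mcoeffD !mcoeff_lmap // raddfD scalerDr.
Qed.
End Tensor.

(* A linear form that separates finitely many exponents reduces the product  *)
(* of leading terms to the one-variable case.                                *)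
Lemma separating_weight (d : nat) (s : seq 'rV[int]_d) :
  exists w : 'cV[int]_d, forall m, m \in s -> m != 0 -> m *m w != 0.
Proof.
pose P (m : 'rV[int]_d) : {poly int} := \poly_(i < d) oapp (m 0) 0 (insub i).
have P0 m : m != 0 -> P m != 0.
  apply: contra_neq => m0; apply/rowP => i; rewrite mxE.
  by have := congr1 (fun p : {poly int} => p`_i) m0; rewrite coef_poly ltn_ord valK coef0.
pose Q := \prod_(m <- s | m != 0) P m.
have Q0 : Q != 0 by rewrite prodf_seq_neq0; apply/allP => m _; apply/implyP/P0.
(* These are [size Q] distinct integers, more than Q can have roots. A non-root b gives the weights
   1, b, b^2, ..., for which the weight of m is the value of [P m] at b. *)
pose rs := [seq (i%:Z) | i <- iota 0 (size Q)].
have /allPn[b _ Qb] : ~~ all (root Q) rs.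
  apply/negP => /(max_poly_roots Q0).
  rewrite map_inj_uniq ?iota_uniq; last by move=> x y [].
  by rewrite size_map size_iota ltnn => /(_ isT).
exists (\col_i b ^+ i) => m ms m0.
apply: contraNneq Qb => mw; rewrite /Q /root horner_prod.
rewrite prodf_seq_eq0; apply/hasP; exists m => //; rewrite m0 /=.
rewrite horner_poly; have := congr1 (fun x : 'M_1 => x 0 0) mw.
rewrite !mxE => mw0; apply/eqP/(etrans _ mw0); apply: eq_bigr => i _.
by rewrite !mxE valK.
Qed.

Section LaurentDomain.
Variables (R : idomainType) (d : nat).
Implicit Types p q : laurent R d.

Lemma mcoeffM_pair p q (m : 'rV[int]_d) :
  (p * q)@_m = \sum_(a <- msupp p) \sum_(b <- msupp q) (p@_a * q@_b) *+ (a + b == m).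
Proof.
have -> : p * q = \sum_(a <- msupp p) \sum_(b <- msupp q)
    lterm (p@_a * q@_b) (a + b).
  by rewrite /GRing.mul /= lmul.unlock.
rewrite raddf_sum; apply: eq_bigr => a _.
rewrite raddf_sum; apply: eq_bigr => b _; exact: mcoeff_lterm.
Qed.

(** For a weight that separates the exponents of each factor, p and q have unique terms of largest
    weight, and nothing cancels the product of these two. *)
Lemma laurent_integral p q : p * q = 0 -> p = 0 \/ q = 0.
Proof.
move=> pq0; have [->|p0] := eqVneq p 0; first by left.
have [->|q0] := eqVneq q 0; first by right.
pose D := [seq a - b | a <- msupp p, b <- msupp p]
       ++ [seq a - b | a <- msupp q, b <- msupp q].
have [w hw] := separating_weight D.
pose v (m : 'rV[int]_d) : int := (m *m w) 0 0.
have vD : {morph v : a b / a + b} by move=> a b; rewrite /v mulmxDl mxE.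
have lead (r : laurent R d) : r != 0 ->
    {subset [seq a - b | a <- msupp r, b <- msupp r] <= D} ->
    exists2 a, a \in msupp r & forall b, b \in msupp r -> b != a -> v b < v a.
  move=> r0 sD; have /fset0Pn[a0 a0r] : msupp r != fset0.
    apply: contraNneq r0 => s0; rewrite [r]laurentE s0 big_seq_fset0.
    exact: eqxx.
  have [a ar amax] : exists2 a, a \in msupp r & forall b, b \in msupp r -> v b <= v a.
    have := @arg_maxP _ _ _ [` a0r]%fset xpredT (fun x => v (val x)) isT.
    case=> a _ ha; exists (val a); first exact: valP.
    by move=> b br; apply: (ha [` br]%fset).
  exists a => // b br ba; rewrite lt_neqAle amax // andbT.
  have : (b - a) *m w != 0.
    apply: hw; last by rewrite subr_eq0.
    by apply/sD/allpairsP; exists (b, a); split.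
  apply: contraNneq => vab; apply/eqP/rowP => i; rewrite ord1 mulmxBl !mxE.
  by move: vab; rewrite /v !mxE => ->; rewrite subrr.
have [|a ap amax] := lead p p0; first by move=> x; rewrite mem_cat => ->.
have [|b bq bmax] := lead q q0; first by move=> x; rewrite mem_cat orbC => ->.
have := congr1 (mcoeff (a + b)) pq0; rewrite mcoeffM_pair mcoeff0.
have unlike a' b' : a' \in msupp p -> b' \in msupp q ->
    a' + b' == a + b -> a' = a /\ b' = b.
  move=> a'p b'q /eqP ab.
  have /eqP : v a' + v b' = v a + v b by rewrite -!vD ab.
  have [a'a|a'a] := eqVneq a' a.
    by move: ab; rewrite a'a => /addrI.
  have lea := amax _ a'p a'a.
  have leb : v b' <= v b.
    by have [->//|b'b] := eqVneq b' b; rewrite ltW // bmax.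
  by rewrite lt_eqF // ltr_leD.
rewrite (big_fsetD1 a ap) /= (big_fsetD1 b bq) /= eqxx.
rewrite !big1_fset => [|a' |b'].
- move/eqP; rewrite !addr0 mulr1n mulf_eq0 !mcoeff_eq0 ap bq //.
- rewrite in_fsetD1 => /andP[a'a a'p] _; rewrite big1_fset // => b' b'q _.
  by case: eqP => // /eqP /unlike -[] // /eqP; rewrite (negbTE a'a).
rewrite in_fsetD1 => /andP[b'b b'q] _.
by case: eqP => // /eqP /unlike -[] // _ /eqP; rewrite (negbTE b'b).
Qed.
End LaurentDomain.

(** * Algebra morphisms and monomial maps *)

Section Factor.
Variables (A B C : comNzRingType) (p : {rmorphism A -> B}) (q : {rmorphism A -> C}).
Hypothesis p_surj : surjective_fun p.
Hypothesis pq : forall a, p a = 0 -> q a = 0.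

(** The value is taken at a chosen preimage; by [factorE] the choice does not matter. The hypotheses
    are arguments so that structure instances can be attached to the map. *)
Definition factor (p_surj : surjective_fun p) (pq : forall a, p a = 0 -> q a = 0)
  (b : B) : C := q (projT1 (cid (p_surj b))).

Local Notation fac := (factor p_surj pq).

Lemma factorE a : fac (p a) = q a.
Proof.
rewrite /factor; case: cid => a' /= pa; apply/eqP; rewrite -subr_eq0 -rmorphB.
by apply/eqP/pq; rewrite rmorphB pa subrr.
Qed.

Lemma factor_zmod : zmod_morphism fac.
Proof.
move=> b b'; have [a <-] := p_surj b; have [a' <-] := p_surj b'.
by rewrite -rmorphB !factorE rmorphB.
Qed.

Lemma factor_monoid : monoid_morphism fac.
Proof.
split=> [|b b']; first by rewrite -(rmorph1 p) factorE rmorph1.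
have [a <-] := p_surj b; have [a' <-] := p_surj b'.
by rewrite -rmorphM !factorE rmorphM.
Qed.

HB.instance Definition _ := GRing.isZmodMorphism.Build B C fac factor_zmod.
HB.instance Definition _ := GRing.isMonoidMorphism.Build B C fac factor_monoid.
End Factor.

Section FactorAlg.
Variables (k : fieldType) (A B C : comAlgType k).
Variables (p : {lrmorphism A -> B}) (q : {lrmorphism A -> C}).
Hypothesis p_surj : surjective_fun p.
Hypothesis pq : forall a, p a = 0 -> q a = 0.

Lemma factor_scalable : scalable (factor p_surj pq).
Proof.
have E a : factor p_surj pq (p a) = q a by exact: factorE.
by move=> c b; have [a <-] := p_surj b; rewrite E -[c *: p a]linearZ -[RHS]linearZ; exact: E.
Qed.
HB.instance Definition _ := GRing.isScalable.Build k B C *:%R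
  (factor p_surj pq) factor_scalable.
End FactorAlg.

Section Image.
Variables (k : fieldType) (A B : comAlgType k) (g : {lrmorphism A -> B}).

Definition image_pred (g : {lrmorphism A -> B}) : {pred B} :=
  fun b => `[< exists a, g a = b >].

Lemma image_predP b : reflect (exists a, g a = b) (b \in image_pred g).
Proof. exact: asboolP. Qed.

Lemma image_subalg_closed : subalg_closed (image_pred g).
Proof.
split=> [|c _ _ /image_predP[a <-] /image_predP[a' <-]
         |_ _ /image_predP[a <-] /image_predP[a' <-]]; apply/image_predP.
- by exists 1; rewrite rmorph1.
- by exists (c *: a + a'); rewrite linearP.
- by exists (a * a'); rewrite rmorphM.
Qed.

HB.instance Definition _ :=
  GRing.isSubalgClosed.Build k B (image_pred g) image_subalg_closed.

Record image_alg (g : {lrmorphism A -> B}) : Type :=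
  ImageAlg {image_val :> B; image_valP : image_val \in image_pred g}.
HB.instance Definition _ := [isSub for @image_val g].
HB.instance Definition _ := [Choice of image_alg g by <:].
HB.instance Definition _ := [SubChoice_isSubAlgebra of image_alg g by <:].
HB.instance Definition _ := [SubNzRing_isSubComNzRing of image_alg g by <:].

Lemma image_val_linear : linear (@image_val g).
Proof. by []. Qed.
Lemma image_val_monoid : monoid_morphism (@image_val g).
Proof. by []. Qed.
HB.instance Definition _ := GRing.isLinear.Build k (image_alg g) B
  *:%R (@image_val g) image_val_linear.
HB.instance Definition _ := GRing.isMonoidMorphism.Build (image_alg g)
  B (@image_val g) image_val_monoid.

Section Corestrict.
Variables (A' : comAlgType k) (h : {lrmorphism A' -> B}).
Hypothesis hg : forall a, h a \in image_pred g.
Definition corestrict (hg : forall a, h a \in image_pred g) a := ImageAlg (hg a).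
Local Notation cor := (corestrict hg).
Lemma corestrict_linear : linear cor.
Proof. by move=> c a a'; apply: val_inj; rewrite /= linearP. Qed.
Lemma corestrict_monoid : monoid_morphism cor.
Proof. by split=> [|a a']; apply: val_inj; rewrite /= ?rmorph1 ?rmorphM. Qed.
HB.instance Definition _ := GRing.isLinear.Build k A' (image_alg g)
  *:%R cor corestrict_linear.
HB.instance Definition _ := GRing.isMonoidMorphism.Build A'
  (image_alg g) cor corestrict_monoid.
End Corestrict.

Lemma mem_image_pred a : g a \in image_pred g.
Proof. by apply/image_predP; exists a. Qed.
End Image.

(** * Comorphisms of torus homomorphisms *)

Section MonomialMap.
Variables (k : fieldType) (e d : nat).

Definition lmon (A : 'M[int]_(e, d)) : laurent k e -> laurent k d :=
  leval (in_alg (laurent k d)) (fun m => lterm 1 (m *m A)).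

Variable A : 'M[int]_(e, d).
Local Notation lmA := (lmon A).

Lemma lmon_lterm c m : lmA (lterm c m) = lterm c (m *m A).
Proof. by rewrite /lmon leval_lterm /= mulr_algl lscaleU mulr1. Qed.

Lemma lmon_linear : linear lmA.
Proof.
move=> c p q; rewrite /lmon levalD levalZ; congr (_ + _).
exact: mulr_algl.
Qed.

Lemma lmon_monoid : monoid_morphism lmA.
Proof.
split; first by rewrite laurent1E lmon_lterm mul0mx.
move=> p q; apply: (@levalM _ _ _ _ _ (fun=> True)) => // a b _ _.
by rewrite ltermM mulr1 mulmxDl.
Qed.

HB.instance Definition _ := GRing.isLinear.Build k (laurent k e) (laurent k d)
  *:%R lmA lmon_linear.
HB.instance Definition _ := GRing.isMonoidMorphism.Build (laurent k e)
  (laurent k d) lmA lmon_monoid.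

Lemma lmonD : {morph lmA : p q / p + q}.
Proof. exact: levalD. Qed.

Lemma lmon_torus_hom : torus_hom (lmA : {lrmorphism laurent k e -> laurent k d}).
Proof.
apply: (@laurent_addr_ext _ _ _ (fun p => comul (lmA p))
  (fun p => ltensor (lmA : laurent k e -> laurent k d) lmA (comul p))).
- move=> p q.
  exact: etrans (congr1 (@comul k d) (lmonD p q)) (comulD _ _).
- move=> p q; apply: etrans (congr1 _ (comulD p q)) _; exact: ltensorD.
move=> c m; rewrite lmon_lterm [LHS]comul_lterm [comul (lterm c m)]comul_lterm.
rewrite [RHS]ltensor_lterm /= !lmon_lterm.
rewrite lmap_lterm => [|x y]; last exact: scalerDl.
by rewrite scale1r.
Qed.
End MonomialMap.

Definition nonneg_on (n : nat) (E : {set 'I_n}) (m : 'rV[int]_n) : Prop :=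
  forall i, i \in E -> 0 <= m 0 i.

Lemma nonneg_onD n (E : {set 'I_n}) a b :
  nonneg_on E a -> nonneg_on E b -> nonneg_on E (a + b).
Proof. by move=> ha hb i iE; rewrite mxE addr_ge0 ?ha ?hb. Qed.

Lemma nonneg_on0 n (E : {set 'I_n}) : nonneg_on E 0.
Proof. by move=> i _; rewrite mxE. Qed.

(** The binomial x^(a+) - x^(a-) is a function on W even when x^a is not, and on the torus it cuts
    out x^a = 1. *)
Definition pos_part (n : nat) (a : 'rV[int]_n) : 'rV[int]_n :=
  \row_i (if 0 <= a 0 i then a 0 i else 0).

Lemma pos_part_nonneg n (E : {set 'I_n}) (a : 'rV_n) : nonneg_on E (pos_part a).
Proof. by move=> i _; rewrite mxE; case: ifP. Qed.

Lemma pos_partB n (a : 'rV_n) : pos_part a - pos_part (- a) = a.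
Proof. by apply/rowP => i; rewrite !mxE; move: (a 0 i) => x; do 2 case: ifP; lia. Qed.

Section TaffineMonomials.
Variables (k : fieldType) (n : nat) (E : {set 'I_n}).
Implicit Types (m a b : 'rV[int]_n) (w : taffine k E).

(** The value is 0 when the exponent is negative somewhere on E, so that all of Z^n can index
    monomials of W. *)
Definition tmon m : taffine k E := insubd 0 (lterm 1 m).

Lemma val_tmon m : nonneg_on E m -> taffine_val (tmon m) = lterm 1 m.
Proof. by move=> hm; apply: (@insubdK _ _ (taffine k E)); exact: taffine_pred_lterm. Qed.

Lemma val_tmonZ c m : nonneg_on E m -> taffine_val (c *: tmon m) = lterm c m.
Proof. by move=> hm; rewrite linearZ /= val_tmon // lscaleU mulr1. Qed.

Lemma taffine_ind (P : taffine k E -> Prop) :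
  (forall v w, P v -> P w -> P (v + w)) ->
  (forall c m, nonneg_on E m -> P (c *: tmon m)) -> forall w, P w.
Proof.
move=> PD PU [p hp]; have hs := elimT (taffine_predP _ p) hp.
(* With the membership proof under an existential, this is a property of the Laurent polynomial
   alone, to which [laurent_supp_ind] applies. *)
suff : exists2 hp' : p \in taffine_pred E, True & P (TAffine hp').
  by case=> hp' _; rewrite (bool_irrelevance hp hp').
move: p hs {hp}; apply: laurent_supp_ind => [|p q [hp _ Pp] [hq _ Pq]|c m hm].
- exists (rpred0 _) => //.
  have -> : TAffine (rpred0 (taffine_pred E)) = 0 *: tmon 0 :> taffine k E.
    by apply: val_inj; rewrite scale0r.
  exact/PU/nonneg_on0.
- exists (rpredD hp hq) => //; have := PD _ _ Pp Pq.
  by congr P; apply: val_inj.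
exists (taffine_pred_lterm c hm) => //; have := PU c m hm.
by congr P; apply: val_inj; exact: val_tmonZ.
Qed.

Lemma taffine_addr_ext (Z : zmodType) (f h : taffine k E -> Z) :
  {morph f : v w / v + w} -> {morph h : v w / v + w} ->
  (forall c m, nonneg_on E m -> f (c *: tmon m) = h (c *: tmon m)) -> f =1 h.
Proof.
move=> fD hD fh; elim/taffine_ind => [v w IHv IHw|//].
by rewrite fD hD IHv IHw.
Qed.

Lemma tmonD a b : nonneg_on E a -> nonneg_on E b ->
  tmon (a + b) = tmon a * tmon b.
Proof.
move=> ha hb; apply: val_inj; rewrite rmorphM /= !val_tmon //.
  by rewrite ltermM mulr1.
exact: nonneg_onD.
Qed.

Lemma tmon0 : tmon 0 = 1.
Proof.
by apply: val_inj; apply: val_tmon; exact: nonneg_on0.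
Qed.

Lemma tmonMn a N : nonneg_on E a -> tmon (a *+ N) = tmon a ^+ N.
Proof.
move=> ha; have hN N' : nonneg_on E (a *+ N').
  by move=> i iE; rewrite mulmxnE mulrn_wge0 ?ha.
elim: N => [|N IHN]; first by rewrite mulr0n tmon0.
by rewrite mulrS tmonD // IHN exprS.
Qed.
End TaffineMonomials.

(* The monomials are the group-like elements of k[T^d]. *)
Lemma torus_hom_matrix (k : fieldType) (e d : nat)
    (phi : {lrmorphism laurent k e -> laurent k d}) : torus_hom phi ->
  exists A : 'M[int]_(e, d), forall m, phi (lterm 1 m) = lterm 1 (m *m A).
Proof.
move=> hphi.
have phiM a b : phi (lterm 1 (a + b)) = phi (lterm 1 a) * phi (lterm 1 b).
  by rewrite -rmorphM /= ltermM mulr1.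
have grouplike m : exists c, phi (lterm 1 m) = lterm 1 c.
  set g := phi _; have g0 : g <> 0.
    move=> g0; have := phiM m (- m); rewrite -/g g0 mul0r subrr.
    rewrite -laurent1E rmorph1 => /eqP; exact/negP/oner_neq0.
  have [c gc] : exists c, g@_c != 0.
    apply: contrapT => h; apply: g0; apply/malgP => c; rewrite mcoeff0.
    by apply/eqP/negbNE/negP => gc; apply: h; exists c.
  (* The coefficients of t^c in the two expressions for the comultiplication of g give g_c t^c = g_c
     g, with g_c nonzero. *)
  exists c; have := congr1 (mcoeff c) (hphi (lterm 1 m)).
  have scaleD (x : laurent k d) : {morph (fun t : k => t *: x) : s t / s + t}.
    by move=> s t; exact: scalerDl.
  rewrite -/g comul_lterm [ltensor _ _ _]ltensor_lterm -/g.
  rewrite (mcoeff_lmap (scaleD _)).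
  have -> : (comul g)@_c = lterm g@_c c.
    elim/laurent_ind: (g) => [p q IHp IHq|x a].
      by rewrite [comul _]comulD !mcoeffD IHp IHq ltermD.
    by rewrite comul_lterm !mcoeff_lterm; case: eqP => [->//|_]; rewrite mulr0n lterm0.
  move=> gE; apply/malgP => a; apply: (mulfI gc).
  have := congr1 (mcoeff a) gE; rewrite mcoeff_lscale => <-.
  by rewrite !mcoeff_lterm mulr_natr.
pose f m := projT1 (cid (grouplike m)).
have fE m : phi (lterm 1 m) = lterm 1 (f m) by rewrite /f; case: cid.
have fD : {morph f : a b / a + b}.
  by move=> a b; apply: (@lterm1_inj k); rewrite -fE phiM !fE ltermM mulr1.
have f0 : f 0 = 0 by apply: (@addrI _ (f 0)); rewrite -fD !addr0.
have fN a : f (- a) = - f a by apply: (@addrI _ (f a)); rewrite -fD !subrr.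
have fZ (z : int) a : f (z *: a) = z *: f a.
  rewrite -[z]intz !scaler_int; case: z => N; rewrite /intmul; last first.
    by rewrite fN; congr (- _); elim: N.+1 => [|N' IH]; rewrite ?mulr0n ?mulrS ?fD ?IH.
  by elim: N => [|N' IH]; rewrite ?mulr0n ?mulrS ?fD ?IH.
exists (\matrix_(i, j) f (delta_mx 0 i) 0 j) => m; rewrite fE; congr lterm.
rewrite {1}(row_sum_delta m) (big_morph f fD f0); apply/rowP => j.
by rewrite summxE mxE; apply: eq_bigr => i _; rewrite fZ !mxE.
Qed.

(** * Toric subvarieties *)

(* The closure in TA^n_E of the image of T^rho under the homomorphism with    *)
(* comorphism t^m |-> t^(mP).                                                 *)
Section ToricSubvariety.
Variables (k : fieldType) (n rho : nat) (E : {set 'I_n}).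
Variable P : 'M[int]_(n, rho).
Local Notation W := (taffine k E).
Local Notation L := (laurent k rho).

Definition subtorus_map : {lrmorphism W -> L} := lmon P \o @taffine_val k n E.
Local Notation g := subtorus_map.
Local Notation A := (image_alg g).

Definition subtorus_proj : {lrmorphism W -> A} := corestrict (mem_image_pred g).
Local Notation iV := subtorus_proj.
Definition subtorus_incl : {lrmorphism A -> L} := @image_val _ _ _ g.
Local Notation jV := subtorus_incl.

Lemma subtorus_map_mon c m : nonneg_on E m -> g (c *: tmon k E m) = lterm c (m *m P).
Proof.
by move=> hm; exact: etrans (congr1 (lmon P) (val_tmonZ c hm)) (lmon_lterm P c m).
Qed.

Lemma subtorus_proj_surj : surjective_fun iV.
Proof.
move=> [b hb]; have /image_predP[a ab] := hb; exists a.
exact: val_inj.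
Qed.

Lemma subtorus_incl_proj w : jV (iV w) = g w. Proof. by []. Qed.

Lemma subtorus_incl_inj : injective jV.
Proof. by move=> a b; apply: val_inj. Qed.

Lemma subtorus_proj_ker w : iV w = 0 <-> lmon P (taffine_val w) = 0.
Proof.
split=> [w0|w0]; first by have := congr1 jV w0; rewrite rmorph0.
by apply: subtorus_incl_inj; rewrite rmorph0; exact: w0.
Qed.

Definition subtorus_coef : {rmorphism k -> laurent A rho} :=
  in_alg (laurent A rho) \o in_alg A.

(** The coaction sends x^m to x^m tensor t^(mP). It is defined on W first, and descends to V by
    [subtorus_coact_ker]. *)
Definition subtorus_coact (w : W) : laurent A rho :=
  leval subtorus_coef (fun m => lterm (iV (tmon k E m)) (m *m P)) (taffine_val w).
Local Notation tau := subtorus_coact.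

Lemma subtorus_coact_mon c m : nonneg_on E m ->
  tau (c *: tmon k E m) = lterm (c *: iV (tmon k E m)) (m *m P).
Proof.
move=> hm; rewrite /tau val_tmonZ // leval_lterm /=.
by rewrite mulr_algl lscaleU mulr_algl.
Qed.

Lemma subtorus_coact_zmod : zmod_morphism tau.
Proof. by move=> v w; rewrite /tau raddfB levalB. Qed.

Lemma subtorus_coactD : {morph tau : v w / v + w}.
Proof. by move=> v w; rewrite /tau raddfD levalD. Qed.

Lemma subtorus_coact_monoid : monoid_morphism tau.
Proof.
split.
  rewrite /tau rmorph1; apply: leval1.
  by rewrite tmon0 rmorph1 mul0mx.
move=> [v hv] [w hw]; rewrite /tau rmorphM /=.
apply: (@levalM _ _ _ _ _ (nonneg_on E)) => [a b ha hb||].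
- by rewrite tmonD // rmorphM ltermM mulmxDl.
- exact: elimT (taffine_predP _ _) hv.
- exact: elimT (taffine_predP _ _) hw.
Qed.

HB.instance Definition _ := GRing.isZmodMorphism.Build W (laurent A rho)
  tau subtorus_coact_zmod.
HB.instance Definition _ := GRing.isMonoidMorphism.Build W (laurent A rho)
  tau subtorus_coact_monoid.

Let jVD : {morph jV : x y / x + y}. Proof. by move=> x y; rewrite rmorphD. Qed.

Lemma subtorus_coact_comul w : lmap jV (tau w) = comul (g w).
Proof.
move: w; apply: taffine_addr_ext => [v w|v w|c m hm].
- exact: etrans (congr1 (lmap jV) (subtorus_coactD v w)) (lmapD jVD _ _).
- exact: etrans (congr1 (@comul k rho) (raddfD g v w)) (comulD _ _).
rewrite subtorus_coact_mon // subtorus_map_mon //.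
rewrite (lmap_lterm jVD) comul_lterm; congr lterm.
exact: etrans (congr1 jV (esym (linearZ_LR iV c (tmon k E m)))) (subtorus_map_mon c hm).
Qed.

(** Since [jV] is injective, the coefficients can be tested after applying it, where
    [subtorus_coact_comul] turns them into those of [comul 0]. *)
Lemma subtorus_coact_ker w : iV w = 0 -> tau w = 0.
Proof.
move=> w0; apply/malgP => m; apply: subtorus_incl_inj.
rewrite mcoeff0 rmorph0.
have := congr1 (mcoeff m) (subtorus_coact_comul w).
rewrite (mcoeff_lmap jVD) => ->.
by rewrite -subtorus_incl_proj w0 rmorph0 comul0 mcoeff0.
Qed.
End ToricSubvariety.

(** * The closure of a subtorus is an affine toric variety *)

Section ToricSubvariety.
Variables (k : fieldType) (n rho : nat) (E : {set 'I_n}).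
Variables (P : 'M[int]_(n, rho)) (Q : 'M[int]_(rho, n)).
Hypothesis QP : Q *m P = 1%:M.
Local Notation W := (taffine k E).
Local Notation L := (laurent k rho).
Local Notation g := (subtorus_map k E P).
Local Notation A := (image_alg g).
Local Notation iV := (subtorus_proj k E P).
Local Notation jV := (subtorus_incl k E P).

(** The rows generate the monoid of exponents that are nonnegative on E: all unit vectors, and their
    opposites outside E. The zero rows for i in E pad the second block. *)
Let gens : 'M[int]_(n + n, n) :=
  col_mx 1%:M (diag_mx (\row_i (if i \in E then 0 else -1))).

Let gensE (m : 'rV_(n + n)) i : (m *m gens) 0 i
  = m 0 (lshift n i) + (if i \in E then 0 else - m 0 (rshift n i)).
Proof.
rewrite -[m in LHS]hsubmxK mul_row_col mulmx1 mxE mul_mx_diag !mxE.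
by case: ifP => _; rewrite ?mulr0 ?mulrN1.
Qed.

Let gens_nonneg m : nonneg_on [set: 'I_(n + n)] m -> nonneg_on E (m *m gens).
Proof. by move=> hm i iE; rewrite gensE iE addr0 hm ?in_setT. Qed.

Let gens_surj m : nonneg_on E m ->
  exists2 m' : 'rV_(n + n), nonneg_on [set: 'I_(n + n)] m' & m' *m gens = m.
Proof.
move=> hm; exists (row_mx (\row_i (if 0 <= m 0 i then m 0 i else 0))
                          (\row_i (if 0 <= m 0 i then 0 else - m 0 i))).
  move=> i _; rewrite -[i]splitK; case: split => j /=.
    by rewrite row_mxEl mxE; case: ifP.
  by rewrite row_mxEr mxE; case: ifP => // /negbT; rewrite -ltNge oppr_ge0 => /ltW.
apply/rowP => i; rewrite gensE row_mxEl row_mxEr !mxE.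
case: ifP => [_|hi]; first by rewrite oppr0 if_same addr0.
by case: ifP => [/hm|_]; rewrite ?hi // opprK add0r.
Qed.

Let gen_map : {lrmorphism taffine k [set: 'I_(n + n)] -> L} :=
  lmon (gens *m P) \o @taffine_val k (n + n) [set: 'I_(n + n)].

Let gen_map_mon c m : nonneg_on [set: 'I_(n + n)] m ->
  gen_map (c *: tmon k _ m) = g (c *: tmon k E (m *m gens)).
Proof.
move=> hm; rewrite subtorus_map_mon; last exact: gens_nonneg.
apply: etrans (congr1 (lmon (gens *m P)) (val_tmonZ c hm)) _.
by rewrite lmon_lterm mulmxA.
Qed.

Let gen_map_mem a : gen_map a \in image_pred g.
Proof.
apply/image_predP; elim/taffine_ind: a => [v w [a av] [b bw]|c m hm].
  exists (a + b); apply: etrans (raddfD g a b) _.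
  exact: etrans (congr2 +%R av bw) (esym (raddfD gen_map v w)).
by exists (c *: tmon k E (m *m gens)); rewrite gen_map_mon.
Qed.

Let gen_map_surj w : exists a, gen_map a = g w.
Proof.
elim/taffine_ind: w => [v w [a av] [b bw]|c m hm].
  exists (a + b); apply: etrans (raddfD gen_map a b) _.
  exact: etrans (congr2 +%R av bw) (esym (raddfD g v w)).
have [m' hm' <-] := gens_surj hm; exists (c *: tmon k _ m').
exact: gen_map_mon.
Qed.

Lemma subtorus_variety : affine_variety A.
Proof.
split=> [a b ab0|].
  have /laurent_integral[a0|b0] : jV a * jV b = 0.
  - by rewrite -rmorphM ab0 rmorph0.
  - by left; apply: (@subtorus_incl_inj k n rho E P); rewrite a0 rmorph0.
  by right; apply: (@subtorus_incl_inj k n rho E P); rewrite b0 rmorph0.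
exists (n + n)%N, (corestrict gen_map_mem) => a.
have [w <-] := subtorus_proj_surj a; have [b bw] := gen_map_surj w.
by exists b; apply: val_inj.
Qed.

(** The exponent of the product of the x_i with i in E; inverting this product turns the closure
    into its torus. *)
Let one_E : 'rV[int]_n := \row_i (if i \in E then 1 else 0).

Let one_E_nonneg : nonneg_on E one_E.
Proof. by move=> i iE; rewrite mxE iE. Qed.

(** One principal open set suffices. As QP = 1, the monomial t^m is the image of x^(mQ), and a power
    of the product of the x_i, i in E, clears the negative exponents on E. *)
Lemma subtorus_open : open_immersion jV.
Proof.
have jx N : jV (iV (tmon k E one_E)) ^+ N = lterm 1 ((one_E *+ N) *m P).
  rewrite -(rmorphXn jV) -(rmorphXn iV) -tmonMn //.
  have hN : nonneg_on E (one_E *+ N).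
    by move=> i iE; rewrite mulmxnE mulrn_wge0 ?one_E_nonneg.
  by rewrite -[tmon _ _ _]scale1r; exact: subtorus_map_mon.
exists 1%N, (fun=> iV (tmon k E one_E)); split.
  exists (fun=> lterm 1 (- (one_E *m P))); rewrite big_ord1.
  apply: etrans (congr1 ( *%R _) (jx 1%N)) _.
  by rewrite mulr1n ltermM mulr1 addNr.
move=> _; split=> [a N h|b].
  by exists N; apply: (@subtorus_incl_inj k n rho E P); rewrite h rmorph0.
(* A bound that holds for all larger exponents lets two summands share one. *)
suff [N hN] : exists N, forall N', (N <= N')%N ->
    exists a, jV (iV (tmon k E one_E)) ^+ N' * b = jV a.
  by have [a ha] := hN N (leqnn N); exists a, N.
elim/laurent_ind: b => [p q [N hN] [N' hN']|c m].
  exists (maxn N N') => N''; rewrite geq_max => /andP[/hN[a ha] /hN'[b hb]].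
  by exists (a + b); rewrite mulrDr ha hb rmorphD.
exists (\sum_i `|(m *m Q) 0%R i|)%N => N hN.
have hm : nonneg_on E (m *m Q + one_E *+ N).
  move=> i iE; rewrite mxE mulmxnE [one_E 0 i]mxE iE natz.
  have : (`|(m *m Q) 0%R i| <= N)%N.
    by apply: leq_trans hN; rewrite (bigD1 i) //= leq_addr.
  move: (_ 0 i) => z; lia.
exists (iV (c *: tmon k E (m *m Q + one_E *+ N))); rewrite jx.
apply/esym/(etrans (subtorus_map_mon P c hm)).
by rewrite ltermM mul1r mulmxDl -mulmxA QP mulmx1 addrC.
Qed.

Lemma subtorus_dense : dense_image jV.
Proof.
move=> a [N]; rewrite -rmorphXn => h; exists N.
by apply: (@subtorus_incl_inj k n rho E P); rewrite h rmorph0.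
Qed.

Lemma subtorus_action :
  exists sigma : {rmorphism A -> laurent A rho}, torus_coaction jV sigma.
Proof.
pose sigma : {rmorphism A -> laurent A rho} :=
  factor (@subtorus_proj_surj k n rho E P) (@subtorus_coact_ker k n rho E P).
have sE w : sigma (iV w) = subtorus_coact P w by exact: factorE.
have jVD : {morph jV : x y / x + y} by move=> x y; rewrite rmorphD.
have sD : {morph sigma : x y / x + y} by move=> x y; rewrite rmorphD.
have sM c m : nonneg_on E m ->
    sigma (iV (c *: tmon k E m)) = lterm (iV (c *: tmon k E m)) (m *m P).
  move=> hm; apply: etrans (sE _) _; apply: etrans (subtorus_coact_mon P c hm) _.
  by congr lterm; apply/esym/(linearZ_LR iV).
exists sigma; split=> [c a|a|a|a].
- have [w <-] := subtorus_proj_surj a.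
  apply: etrans (congr1 sigma (esym (linearZ_LR iV c w))) _; move: w.
  apply: (@taffine_addr_ext k n E _ (fun w => sigma (iV (c *: w)))
     (fun w => (c%:A : A) *: sigma (iV w))).
  + by move=> v w; rewrite scalerDr raddfD sD.
  + by move=> v w; rewrite raddfD sD; exact: scalerDr.
  move=> c' m hm; rewrite scalerA !sM // lscaleU; congr lterm.
  rewrite mulr_algl -scalerA; exact: (linearZ_LR iV).
- have [w <-] := subtorus_proj_surj a; move: w.
  apply: (@taffine_addr_ext k n E _ (fun w => counit (sigma (iV w))) iV).
  + by move=> v w; rewrite raddfD sD counitD.
  + exact: raddfD.
  by move=> c m hm; rewrite sM // counit_lterm.
- have [w <-] := subtorus_proj_surj a; move: w.
  apply: (@taffine_addr_ext k n E _ (fun w => lmap sigma (sigma (iV w)))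
     (fun w => comul (sigma (iV w)))).
  + move=> v w; rewrite raddfD sD; exact: lmapD.
  + move=> v w; rewrite raddfD sD; exact: comulD.
  by move=> c m hm; rewrite sM // lmap_lterm // sM // comul_lterm.
have [w <-] := subtorus_proj_surj a.
exact: etrans (congr1 (lmap jV) (sE w)) (subtorus_coact_comul P w).
Qed.

Definition subtorus_variety_of : toric_variety k :=
  ToricVariety subtorus_variety subtorus_open subtorus_dense subtorus_action.
End ToricSubvariety.

(** Density makes an element of the kernel nilpotent, and the coordinate ring is a domain. *)
Lemma torus_incl_eq0 (k : fieldType) (V : toric_variety k) (a : V) :
  torus_incl V a = 0 -> a = 0.
Proof.
move=> a0; have [|N] := torus_dense (t := V) (a := a).
  by exists 1%N; rewrite expr1.
have [dom _] := toric_is_variety V.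
elim: N => [|N IHN]; last by rewrite exprS => /dom[].
by rewrite expr0 => /eqP; rewrite oner_eq0.
Qed.

Section MonomialMaps.
Variables (k : fieldType).

Lemma lmon_comp n d e (A : 'M[int]_(n, d)) (B : 'M[int]_(d, e)) (p : laurent k n) :
  lmon B (lmon A p) = lmon (A *m B) p.
Proof.
move: p; apply: (@laurent_addr_ext _ _ _ (fun p => lmon B (lmon A p))).
- by move=> p q; rewrite !lmonD.
- exact: lmonD.
by move=> c m; rewrite !lmon_lterm mulmxA.
Qed.

Lemma torus_hom_lmon n d (phi : {lrmorphism laurent k n -> laurent k d}) :
  torus_hom phi -> exists A : 'M[int]_(n, d), forall p, phi p = lmon A p.
Proof.
move=> /torus_hom_matrix[A hA]; exists A.
apply: (@laurent_addr_ext _ _ _ phi) => [||c m].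
- exact: raddfD.
- exact: lmonD.
have cE e' (m' : 'rV_e') : lterm c m' = c *: lterm 1 m' :> laurent k e'.
  by rewrite lscaleU mulr1.
rewrite lmon_lterm !cE -hA; exact: (linearZ_LR phi).
Qed.
Lemma lmon_tmonB n d (E : {set 'I_n}) (A : 'M[int]_(n, d)) u v :
  nonneg_on E u -> nonneg_on E v ->
  lmon A (taffine_val (tmon k E u - tmon k E v))
  = lterm 1 (u *m A) - lterm 1 (v *m A).
Proof.
move=> hu hv; apply: etrans (raddfB (lmon A)
  (taffine_val (tmon k E u)) (taffine_val (tmon k E v))) _.
by rewrite /= !val_tmon // !lmon_lterm.
Qed.

Lemma lmon_pos_part n d (E : {set 'I_n}) (A : 'M[int]_(n, d)) (a : 'rV_n) :
  a *m A = 0 ->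
  lmon A (taffine_val (tmon k E (pos_part a) - tmon k E (pos_part (- a)))) = 0.
Proof.
move=> aA; rewrite lmon_tmonB; [|exact: pos_part_nonneg..].
suff -> : pos_part a *m A = pos_part (- a) *m A by rewrite subrr.
by apply/eqP; rewrite -subr_eq0 -mulmxBl pos_partB aA.
Qed.
End MonomialMaps.

Section ToricBetween.
Variables (k : fieldType) (n rho : nat) (E : {set 'I_n}).
Variables (P : 'M[int]_(n, rho)) (Q : 'M[int]_(rho, n)).
Hypothesis QP : Q *m P = 1%:M.
Local Notation W := (taffine k E).
Local Notation V := (subtorus_variety_of k E QP).
Local Notation iV := (subtorus_proj k E P).
Local Notation jV := (subtorus_incl k E P).

Lemma subtorus_in_TA : toric_in_TA (iV : {lrmorphism W -> V}).
Proof.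
split; first exact: subtorus_proj_surj.
exists (lmon P); split=> //; exact: lmon_torus_hom.
Qed.

Variables (X : toric_variety k) (iX : {lrmorphism W -> X}).
Variables (AX : 'M[int]_(n, torus_dim X)).
Hypothesis iX_surj : surjective_fun iX.
Hypothesis iXE : forall w, lmon AX (taffine_val w) = torus_incl X (iX w).
Hypothesis kerP : forall m : 'rV_n, m *m P = 0 -> m *m AX = 0.


(** The rows of [P *m Q - 1] are killed by P because QP = 1, hence by [AX]. So the torus of X maps
    to that of W through the torus of V, with matrix [Q *m AX]. *)
Let AXE : P *m (Q *m AX) = AX.
Proof.
apply/row_matrixP => i; apply/eqP; rewrite -subr_eq0 !rowE -mulmxBr mulmxA.
rewrite -[X in _ - X]mul1mx -mulmxBl mulmxA.
by apply/eqP/kerP; rewrite -mulmxA mulmxBl -mulmxA QP mulmx1 mul1mx subrr mulmx0.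
Qed.

Lemma subtorus_between : toric_between iX (iV : {lrmorphism W -> V}).
Proof.
split; first exact: subtorus_in_TA.
have iXE2 w : lmon (Q *m AX) (jV (iV w)) = torus_incl X (iX w).
  by apply: etrans (lmon_comp P (Q *m AX) (taffine_val w)) _; rewrite AXE iXE.
have iVX w : iV w = 0 -> iX w = 0.
  by move=> w0; apply: torus_incl_eq0; rewrite -iXE2 w0 !rmorph0.
pose f : {lrmorphism V -> X} := factor (@subtorus_proj_surj k n rho E P) iVX.
have fE w : f (iV w) = iX w by exact: factorE.
exists f; split=> //; split.
  by move=> x; have [w <-] := iX_surj x; exists (iV w).
exists (lmon (Q *m AX)); split; last exact: lmon_torus_hom.
move=> v; have [w <-] := subtorus_proj_surj v.
by apply: etrans (iXE2 w) _; rewrite -fE.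
Qed.
End ToricBetween.

(** * Parameters of local rings *)

Section Ideals.
Variable R : comNzRingType.
Implicit Types (I S : R -> Prop).

Lemma ideal_sum I (T : finType) (F : T -> R) :
  is_ideal I -> (forall i, I (F i)) -> I (\sum_i F i).
Proof. by case=> I0 ID _ hF; elim/big_ind: _. Qed.

Lemma idealB I a b : is_ideal I -> I a -> I b -> I (a - b).
Proof. by case=> _ ID IM Ia Ib; rewrite -mulN1r; apply/ID/IM. Qed.

Lemma mem_ideal_span S x : S x -> ideal_span S x.
Proof.
by move=> Sx; exists 1%N, (fun=> 1), (fun=> x); split=> //; rewrite big_ord1 mul1r.
Qed.

Lemma ideal_span_ideal S : is_ideal (ideal_span S).
Proof.
split.
- exists 0%N, (fun=> 0), (fun=> 0).
  by split=> [[]//|]; rewrite big_ord0.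
- move=> _ _ [r [c [s [hs ->]]]] [r' [c' [s' [hs' ->]]]].
  exists (r + r')%N, (fun i => match split i with inl j => c j | inr j => c' j end).
  exists (fun i => match split i with inl j => s j | inr j => s' j end).
  split=> [i|]; first by case: split.
  rewrite big_split_ord; congr (_ + _); apply: eq_bigr => i _.
    by rewrite (unsplitK (inl i)).
  by rewrite (unsplitK (inr i)).
move=> a _ [r [c [s [hs ->]]]]; exists r, (fun i => a * c i), s.
by split=> //; rewrite mulr_sumr; apply: eq_bigr => i _; rewrite mulrA.
Qed.

Lemma ideal_span_sub S I :
  is_ideal I -> (forall x, S x -> I x) -> forall x, ideal_span S x -> I x.
Proof.
move=> hI SI _ [r [c [s [hs ->]]]]; have [_ _ IM] := hI.
by apply: ideal_sum => // i; apply/IM/SI.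
Qed.

Definition prime_ideal I : Prop :=
  [/\ is_ideal I, ~ I 1 & forall a b, I (a * b) -> I a \/ I b].

Lemma maximal_prime I : maximal_ideal I -> prime_ideal I.
Proof.
case=> hI I1 Imax; split=> // a b Iab; have [I0 ID IM] := hI.
case: (pselect (I a)) => [|nIa]; first by left.
pose J x := exists u v, I u /\ x = u + v * a.
have [|x Ix|[u [v [Iu uv1]]]|JI] := Imax J.
- split.
  + by exists 0, 0; rewrite mul0r addr0.
  + move=> _ _ [u [v [Iu ->]]] [u' [v' [Iu' ->]]]; exists (u + u'), (v + v').
    by rewrite mulrDl addrACA; split=> //; apply: ID.
  move=> c _ [u [v [Iu ->]]]; exists (c * u), (c * v).
    by rewrite mulrDr mulrA; split=> //; apply: IM.
- by exists x, 0; rewrite mul0r addr0.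
- right; rewrite -[b]mul1r uv1 mulrDl -mulrA mulrC.
  by apply: ID; apply: IM.
by case: nIa; apply: JI; exists 0, 1; rewrite mul1r add0r.
Qed.

Lemma invertible_mul (x y : R) : invertible x -> invertible y -> invertible (x * y).
Proof.
by move=> [x' xx'] [y' yy']; exists (x' * y'); rewrite mulrACA xx' yy' mulr1.
Qed.

Lemma invertible_mulr (x y : R) : invertible (x * y) -> invertible y.
Proof. by move=> [z xyz]; exists (x * z); rewrite mulrA [y * x]mulrC. Qed.

Lemma invertible_mull (x y : R) : invertible (x * y) -> invertible x.
Proof. by rewrite mulrC; exact: invertible_mulr. Qed.
End Ideals.

Section Localization.
Variables (R O : comNzRingType) (M : R -> Prop) (l : {rmorphism R -> O}).
Hypotheses (primeM : prime_ideal M) (locM : is_localization_at M l).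

Lemma localization_nonunit a : ~ invertible (l a) <-> M a.
Proof.
have [[M0 MD MM] M1 Mp] := primeM; have [lu lf l0] := locM.
split=> [ha|Ma [y ly]]; first by apply: contrapT => /lu.
have [b [t [nMt yt]]] := lf y.
have [|u [nMu ut]] := l0 (a * b - t).
  by rewrite rmorphB rmorphM -yt mulrA ly mul1r subrr.
have /Mp[//|//] : M (u * t).
move/eqP: ut; rewrite mulrBr subr_eq0 => /eqP <-.
by rewrite mulrCA mulrC; apply: MM.
Qed.

Lemma localization_local : is_ideal (fun x : O => ~ invertible x).
Proof.
have [[M0 MD MM] M1 Mp] := primeM; have [lu lf l0] := locM.
have nonunit x a s : ~ M s -> x * l s = l a -> ~ invertible x <-> M a.
  move=> /lu us xs; rewrite -localization_nonunit -xs; split; apply: contra_not.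
    exact: invertible_mull.
  by move=> ux; apply: invertible_mul.
split.
- by move=> [y]; rewrite mul0r => /esym/eqP; rewrite oner_eq0.
- move=> x y; have [a [s [ns xs]]] := lf x; have [b [t [nt yt]]] := lf y.
  rewrite (nonunit _ _ _ ns xs) (nonunit _ _ _ nt yt) => Ma Mb.
  apply/(nonunit _ (t * a + s * b) (s * t)) => [/Mp[]//||].
    by rewrite rmorphD !rmorphM -xs -yt; ring.
  by apply: MD; apply: MM.
by move=> c a na; apply: contra_not na; exact: invertible_mulr.
Qed.
End Localization.

Definition subring_like (R : comNzRingType) (A : R -> Prop) : Prop :=
  [/\ A 1, forall x y, A x -> A y -> A (x - y) &
      forall x y, A x -> A y -> A (x * y)].

Section SubringLike.
Variables (R : comNzRingType) (A : R -> Prop).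
Hypothesis hA : subring_like A.
Lemma subring_like0 : A 0.
Proof. by case: hA => A1 AB _; rewrite -(subrr 1); apply: AB. Qed.
Lemma subring_likeN x : A x -> A (- x).
Proof. by case: hA => _ AB _ Ax; rewrite -sub0r; apply/AB/Ax/subring_like0. Qed.
Lemma subring_likeD x y : A x -> A y -> A (x + y).
Proof.
by move=> Ax /subring_likeN Ay; case: hA => _ AB _; rewrite -[y]opprK; apply: AB.
Qed.
Lemma subring_like_sum (T : finType) (F : T -> R) :
  (forall i, A (F i)) -> A (\sum_i F i).
Proof.
by move=> hF; elim/big_ind: _ => //; [exact: subring_like0|exact: subring_likeD].
Qed.
Lemma subring_likeX x n : A x -> A (x ^+ n).
Proof.
case: hA => A1 _ AM Ax; elim: n => [|n IHn]; first by rewrite expr0.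
by rewrite exprS; apply: AM.
Qed.
End SubringLike.

Section LocalParameters.
Variable O : comNzRingType.
Hypothesis localO : is_ideal (fun x : O => ~ invertible x).
Local Notation mO x := (~ invertible x).

Definition adjoin (A : O -> Prop) (z : O) : O -> Prop :=
  fun x => exists g : {poly O}, (forall i, A g`_i) /\ x = g.[z].

Lemma adjoin_subring A z : subring_like A -> subring_like (adjoin A z).
Proof.
move=> hA; have [A1 AB AM] := hA; split.
- exists 1%:P; rewrite hornerC; split=> // i; rewrite coefC.
  by case: ifP => // _; exact: subring_like0.
- move=> _ _ [f [hf ->]] [g [hg ->]]; exists (f - g).
  by rewrite hornerD hornerN; split=> // i; rewrite coefB; apply: AB.
move=> _ _ [f [hf ->]] [g [hg ->]]; exists (f * g); rewrite hornerM; split=> // i.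
by rewrite coefM; apply: subring_like_sum => // j; apply: AM.
Qed.

Lemma adjoin_base A z x : subring_like A -> A x -> adjoin A z x.
Proof.
move=> hA Ax; exists x%:P; rewrite hornerC; split=> // i; rewrite coefC.
by case: ifP => // _; exact: subring_like0.
Qed.

Lemma adjoin_gen A z : subring_like A -> adjoin A z z.
Proof.
move=> hA; exists 'X; rewrite hornerX; split=> // i; rewrite coefX.
by case: hA (subring_like0 hA) => A1 _ _ A0; case: eqP.
Qed.

(** On the fibre of Spec A[z] over the point of Spec A, which lies on a line over the residue field,
    y is an equation of the point: the part of the maximal ideal in A[z] is generated by y and by
    the part in A. *)
Definition fiber_generator (A : O -> Prop) (z y : O) : Prop :=
  mO y /\ forall x, adjoin A z x -> mO x ->
    exists u, ideal_span (fun a => A a /\ mO a) (x - u * y).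

(** A point z = c of the fibre has the equation z - c, by the factor theorem. This is how prescribed
    parameters are kept. *)
Lemma fiber_generator_shift A z c :
  subring_like A -> A c -> mO (z - c) -> fiber_generator A z (z - c).
Proof.
move=> hA Ac mzc; split=> // _ [g [hg ->]] mg.
have /factor_theorem[q gq] : root (g - g.[c]%:P) c.
  by rewrite /root hornerD hornerN hornerC subrr.
have gz : g.[z] - q.[z] * (z - c) = g.[c].
  have := congr1 (fun p => p.[z]) gq.
  rewrite hornerD hornerN hornerC hornerM hornerXsubC => <-.
  by rewrite subKr.
exists q.[z]; rewrite gz; apply: mem_ideal_span; split.
  rewrite horner_coef; apply: subring_like_sum => // i.
  by case: hA (subring_likeX hA i Ac) => _ _ AM; apply: AM.
have [_ _ mM] := localO.
by rewrite -gz; apply: (idealB localO) => //; apply: mM.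
Qed.

(* Modulo the maximal ideal of the local ring of A, the trace of the maximal  *)
(* ideal on A[z] is an ideal of a polynomial ring in one variable over a      *)
(* field, hence principal.                                                    *)
Lemma fiber_generator_exists A z : subring_like A -> exists y, fiber_generator A z y.
Proof.
move=> hA; have [A1 AB AM] := hA; have [m0 mD mM] := localO.
pose J := ideal_span (fun a => A a /\ mO a).
have [J0 JD JM] : is_ideal J by exact: ideal_span_ideal.
(* A bad polynomial is nonzero over the residue field and vanishes at the point. By [good], the
   other polynomials that vanish at the point take values in J. *)
pose bad (g : {poly O}) :=
  [/\ forall i, A g`_i, mO g.[z] & exists i, invertible g`_i].
have good (g : {poly O}) : (forall i, A g`_i) -> mO g.[z] -> ~ bad g -> J g.[z].
  move=> Ag mg nbad; rewrite horner_coef; apply: ideal_sum => // i.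
  rewrite mulrC; apply/JM/mem_ideal_span; split=> // ui.
  by apply: nbad; split=> //; exists i.
case: (pselect (exists g, bad g)) => [|nobad]; last first.
  exists 0; split=> // _ [g [hg ->]] mg; exists 0; rewrite mulr0 subr0.
  by apply: good => // bg; apply: nobad; exists g.
move=> [g0 bg0].
have ex : exists N, `[< exists2 g, bad g & size g = N >].
  by exists (size g0); apply/asboolP; exists g0.
case: (ex_minnP ex) => N /asboolP[f bf sf] Nmin.
have fmin (g : {poly O}) : (size g < size f)%N -> ~ bad g.
  move=> gf bg; have /Nmin : `[< exists2 h, bad h & size h = size g >].
    by apply/asboolP; exists g.
  by rewrite leqNgt -sf gf.
have [Af mf [i0 ui0]] := bf.
have f0 : (0 < size f)%N.
  rewrite size_poly_gt0; apply/eqP => f0; case: m0.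
  by move: ui0; rewrite f0 coef0.
pose c := lead_coef f.
(* If the leading coefficient were a nonunit, dropping the leading term would leave a smaller bad
   polynomial. *)
have [c' cc'] : invertible c.
  apply: contrapT => mc; pose e : {poly O} := c *: 'X^((size f).-1).
  have eE i : e`_i = if i == (size f).-1 then f`_i else 0.
    by rewrite coefZ coefXn; case: eqP => [->|_]; rewrite ?mulr1 ?mulr0.
  apply: (fmin (f - e)).
    suff : (size (f - e)%R <= (size f).-1)%N by lia.
    apply/leq_sizeP => j hj; rewrite coefB eE; case: eqP => [_|]; first by rewrite subrr.
    move=> jf; rewrite subr0 nth_default //; 
    by rewrite -(prednK f0) ltn_neqAle eq_sym hj andbT; apply/eqP.
  split.
  - move=> i; rewrite coefB eE; apply: AB => //.
    by case: ifP => // _; exact: subring_like0.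
  - rewrite hornerD hornerN; apply: (idealB localO) => //.
    by rewrite hornerZ mulrC; apply: mM.
  exists i0; rewrite coefB eE; case: eqP => [i0f|_]; last by rewrite subr0.
  by case: mc; rewrite /c /lead_coef -i0f.
have aux1 p q j : (0 < p -> p <= q -> q.-1 <= j -> (j < q - p) = false)%N by lia.
have aux2 p q : (0 < p -> p <= q -> q.-1 - (q - p) = p.-1)%N by lia.
have aux3 p q j : (p <= q -> q <= j -> p <= j - (q - p))%N by lia.
exists f.[z]; split=> // _ [g [Ag ->]].
have [N' leN'] := ubnP (size g); elim: N' => // N' IH in g Ag leN' * => mg.
have [gf|fg] := ltnP (size g) (size f).
  by exists 0; rewrite mul0r subr0; apply: good => //; exact: fmin.
pose d := (size g - size f)%N; pose b := lead_coef g.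
(* Pseudo-division: g is multiplied by c, because the inverse [c'] of c need not lie in A. The
   inverse enters only the multiplier [u], which ranges over O. *)
pose h := c *: g - b *: ('X^d * f).
have hE i : h`_i = c * g`_i - b * (if (i < d)%N then 0 else f`_(i - d)).
  by rewrite coefB !coefZ coefXnM.
have hz : h.[z] = c * g.[z] - b * z ^+ d * f.[z].
  by rewrite hornerD hornerN !hornerZ hornerM hornerXn mulrA.
have [|||u hu] := IH h.
- move=> i; rewrite hE; apply: AB; apply: AM => //; rewrite ?/c ?/b ?/lead_coef //.
  by case: ifP => // _; exact: subring_like0.
- have sg0 : (0 < size g)%N by exact: leq_trans f0 fg.
  have hg : (size h <= (size g).-1)%N.
    apply/leq_sizeP => j hj; rewrite hE (aux1 _ _ _ f0 fg hj).
    have [jg|jg] := eqVneq j (size g).-1.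
      by rewrite jg aux2 // /c /b /lead_coef mulrC subrr.
    have {}jg : (size g <= j)%N.
      by rewrite -(prednK sg0) ltn_neqAle eq_sym jg hj.
    by rewrite !nth_default ?mulr0 ?subrr // aux3.
 by apply: leq_ltn_trans hg _; rewrite prednK.
- rewrite hz; apply: (idealB localO) => //; first exact: mM.
  exact: mM.
exists (c' * (b * z ^+ d + u)).
suff -> : g.[z] - c' * (b * z ^+ d + u) * f.[z] = c' * (h.[z] - u * f.[z]).
  exact: JM.
rewrite hz -[g.[z] in LHS]mul1r -cc'; ring.
Qed.

Fixpoint tower (A : O -> Prop) (z : nat -> O) (j : nat) : O -> Prop :=
  if j is j'.+1 then adjoin (tower A z j') (z j') else A.

Lemma tower_subring A z j : subring_like A -> subring_like (tower A z j).
Proof. by move=> hA; elim: j => //= j IHj; exact: adjoin_subring. Qed.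

Lemma tower_base A z j x : subring_like A -> A x -> tower A z j x.
Proof.
move=> hA Ax; elim: j => //= j IHj; apply: adjoin_base => //.
exact: tower_subring.
Qed.

Lemma tower_gen A z i j : subring_like A -> (i < j)%N -> tower A z j (z i).
Proof.
move=> hA; elim: j => //= j IHj; rewrite ltnS leq_eqVlt => /predU1P[->|/IHj h].
  exact/adjoin_gen/tower_subring.
by apply: adjoin_base => //; exact: tower_subring.
Qed.

Lemma tower_parameters (A : O -> Prop) (n : nat) (z : 'I_n -> O) (c : 'I_n -> option O) :
  subring_like A -> (forall a, A a -> mO a -> a = 0) ->
  (forall j a, c j = Some a -> A a /\ mO (z j - a)) ->
  exists y : 'I_n -> O,
    [/\ forall j a, c j = Some a -> y j = z j - a, forall j, mO (y j) &
        forall x, mO x ->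
          (forall B, subring_like B -> (forall a, A a -> B a) ->
             (forall j, B (z j)) -> B x) ->
          ideal_span (fun t => exists i, t = y i) x].
Proof.
move=> hA A0 hc; pose zz j := oapp z 0 (insub j : option 'I_n).
have zzE (j : 'I_n) : zz j = z j by rewrite /zz valK.
have step (j : 'I_n) : exists y, fiber_generator (tower A zz j) (z j) y /\
    forall a, c j = Some a -> y = z j - a.
  have hT := tower_subring zz j hA.
  case cj: (c j) => [a|]; last first.
    by have [y hy] := fiber_generator_exists (z j) hT; exists y.
  have [Aa ma] := hc _ _ cj; exists (z j - a); split=> [|_ [<-]//].
  by apply: fiber_generator_shift => //; exact: tower_base.
pose y (j : 'I_n) := projT1 (cid (step j)).
have yP (j : 'I_n) : fiber_generator (tower A zz j) (z j) (y j) /\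
    forall a, c j = Some a -> y j = z j - a by rewrite /y; case: cid.
exists y; split=> [j|j|x mx hx]; [by case: (yP j)|by case: (yP j) => -[]|].
have : tower A zz n x.
  apply: hx => [||j]; first exact: tower_subring.
    by move=> a; exact: tower_base.
  by rewrite -zzE; apply: tower_gen.
set J := ideal_span _; have hJ : is_ideal J by exact: ideal_span_ideal.
(* A nonunit of stage j + 1 is a multiple of y_j plus a combination of nonunits of stage j; at stage
   0 the only nonunit is 0. *)
have [J0 JD JM] := hJ; suff : forall j, (j <= n)%N -> forall x, tower A zz j x -> mO x -> J x.
  by move=> H hT; apply: H hT mx.
elim=> [_ a Aa /(A0 _ Aa) ->//|j IHj jn {}x {}hx {}mx].
pose i := Ordinal jn; have [[myi hyi] _] := yP i.
have [|u hu] := hyi x _ mx; first by rewrite -zzE.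
rewrite -[x](subrK (u * y i)); apply: JD; last first.
  by apply/JM/mem_ideal_span; exists i.
apply: (ideal_span_sub hJ _ hu) => a [Ta ma]; apply: IHj => //.
exact: ltnW.
Qed.
End LocalParameters.

(** * Lattices *)

(* Some point of the closure in TA^n_E of {t | t^a = 1 for all a with aA = 0} *)
(* lies on x_i = 0 for i in F, and on no other hypersurface of E.             *)
Definition is_face n d (A : 'M[int]_(n, d)) (E F : {set 'I_n}) : Prop :=
  F \subset E /\ forall a : 'rV_n, a *m A = 0 ->
    (forall i, i \in F -> 0 <= a 0 i) -> forall i, i \in F -> a 0 i = 0.

(** An exponent that is nonnegative on the union of all faces is so on each of them, hence zero
    there. *)
Lemma maximum_face n d (A : 'M[int]_(n, d)) (E : {set 'I_n}) :
  exists F, is_face A E F /\ forall F', is_face A E F' -> F' \subset F.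
Proof.
exists (\bigcup_(F' | `[< is_face A E F' >]) F'); split; last first.
  by move=> F' hF'; apply: bigcup_sup; apply/asboolP.
split; first by apply/bigcupsP => F' /asboolP[].
move=> a aA a0 i /bigcupP[F' hF' iF']; have /asboolP[_ h] := hF'.
by apply: h => // j jF'; apply: a0; apply/bigcupP; exists F'.
Qed.

Lemma ordinal_sort m (f : pred 'I_m) :
  exists (r rho : nat) (e : 'I_(r + rho) -> 'I_m),
    bijective e /\ forall j, f (e j) = (j < r)%N.
Proof.
pose s1 := enum f; pose s2 := enum (predC f).
have sz : size (s1 ++ s2) == (size s1 + size s2)%N by rewrite size_cat.
exists (size s1), (size s2), (tnth (Tuple sz)).
have us : uniq (s1 ++ s2).
  rewrite cat_uniq !enum_uniq andbT /=; apply/hasPn => x.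
  by rewrite !mem_enum.
have inj : injective (tnth (Tuple sz)) by exact/tuple_uniqP.
split.
  apply: inj_card_bij => //; rewrite !card_ord -size_cat.
  rewrite -{1}(card_ord m) cardE; apply: uniq_leq_size; first exact: enum_uniq.
  by move=> x _; rewrite mem_cat !mem_enum; exact: orbN.
move=> j; set x := tnth _ j; rewrite /x (tnth_nth x) /= nth_cat.
case: ltnP => hj.
  by have := mem_nth x hj; rewrite mem_enum.
have := @mem_nth _ x s2 (j - size s1).
rewrite mem_enum !inE => h; apply/negbTE/h.
by rewrite ltn_subLR.
Qed.

(** The rows of B form a basis of Z^n with inverse C, and [rsubmx C] reads the last [rho]
    coordinates. So the first r rows are a basis of the lattice of all a in the kernel of A that
    vanish on F; the unit vectors of F are among the other rows, and all remaining rows vanish on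
    F. *)
Lemma adapted_basis n d (A : 'M[int]_(n, d)) (F : {set 'I_n}) :
  exists (r rho : nat) (B : 'M[int]_(r + rho, n)) (C : 'M[int]_(n, r + rho)),
    [/\ n = (r + rho)%N, B *m C = 1%:M, C *m B = 1%:M,
        forall a : 'rV_n, a *m rsubmx C = 0 <->
          a *m A = 0 /\ forall i, i \in F -> a 0 i = 0 &
        (forall i, i \in F -> exists j, row (rshift r j) B = delta_mx 0 i) /\
        (forall j, (exists2 i, i \in F & row j B = delta_mx 0 i) \/
                   (forall i, i \in F -> B j i = 0))].
Proof.
pose p := #|~: F|; pose q := #|F|.
pose io : 'I_p -> 'I_n := @enum_val _ (mem (~: F)).
pose ka : 'I_q -> 'I_n := @enum_val _ (mem F).
have io_inj : injective io by exact: enum_val_inj.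
have ka_inj : injective ka by exact: enum_val_inj.
have ioF l : io l \in F = false.
  by have := enum_valP l; rewrite in_setC => /negbTE.
have kaF s : ka s \in F by exact: enum_valP.
have kaP i : i \in F -> exists s, ka s = i.
  by move=> iF; exists (enum_rank_in iF i); exact: enum_rankK_in.
have ioP i : i \notin F -> exists s, io s = i.
  rewrite -in_setC => iF; exists (enum_rank_in iF i); exact: enum_rankK_in.
(* S and K select the coordinates outside F and inside F; together they form a permutation
   matrix. *)
pose S : 'M[int]_(p, n) := \matrix_(l, x) (io l == x)%:R.
pose K : 'M[int]_(q, n) := \matrix_(s, x) (ka s == x)%:R.
have SS : S *m S^T = 1%:M.
  apply/matrixP => l l'; rewrite !mxE (bigD1 (io l)) //= big1 => [|x xl].
    by rewrite !mxE eqxx mul1r addr0 (inj_eq io_inj) eq_sym.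
  by rewrite !mxE eq_sym (negbTE xl) mul0r.
have KK : K *m K^T = 1%:M.
  apply/matrixP => l l'; rewrite !mxE (bigD1 (ka l)) //= big1 => [|x xl].
    by rewrite !mxE eqxx mul1r addr0 (inj_eq ka_inj) eq_sym.
  by rewrite !mxE eq_sym (negbTE xl) mul0r.
have SK : S *m K^T = 0.
  apply/matrixP => l s; rewrite !mxE big1 // => x _; rewrite !mxE.
  case: eqP => [lx|_]; last by rewrite mul0r.
  case: eqP => [sx|_]; last by rewrite mulr0.
  by have := kaF s; rewrite sx -lx ioF.
have KS : K *m S^T = 0 by rewrite -[K]trmxK -trmx_mul SK trmx0.
have SSKK : S^T *m S + K^T *m K = 1%:M.
  apply/matrixP => x y; rewrite !mxE.
  have [xF|xF] := boolP (x \in F).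
    have [s sx] := kaP x xF; rewrite big1 ?add0r => [|l _]; last first.
      by rewrite !mxE; case: eqP => [lx|]; rewrite ?mul0r //; rewrite -lx ioF in xF.
    rewrite (bigD1 s) //= big1 => [|s' ss'].
      by rewrite !mxE sx eqxx mul1r addr0.
    by rewrite !mxE -sx (inj_eq ka_inj) (negbTE ss') mul0r.
  have [s sx] := ioP x xF; rewrite [X in _ + X]big1 ?addr0 => [|l _]; last first.
    by rewrite !mxE; case: eqP => [lx|]; rewrite ?mul0r //; rewrite -lx kaF in xF.
  rewrite (bigD1 s) //= big1 => [|s' ss'].
    by rewrite !mxE sx eqxx mul1r addr0.
  by rewrite !mxE -sx (inj_eq io_inj) (negbTE ss') mul0r.
(* Smith normal form of the rows of A outside F. If a vanishes on F and has coordinates v in the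
   basis of rows of L^-1 S, then aA = vDR; so aA = 0 exactly when v is supported on the zero rows of
   D. *)
have [L Lu [R Ru [dd _ SA]]] := int_Smith_normal_form (S *m A).
set D := (\matrix_(i, j) _) in SA.
pose b := col_mx (invmx L *m S) K.
pose c := row_mx (S^T *m L) K^T.
have bc : b *m c = 1%:M.
  rewrite /b /c mul_col_row -!mulmxA [S *m (_ *m _)]mulmxA SS mul1mx mulVmx //.
  by rewrite SK mulmx0 [K *m (_ *m _)]mulmxA KS mul0mx KK -scalar_mx_block.
have cb : c *m b = 1%:M.
  by rewrite /b /c mul_row_col -mulmxA [L *m (_ *m _)]mulmxA mulmxV // mul1mx.
(* This marks the basis vectors that lie in the lattice; [ordinal_sort] puts them first. *)
pose f (t : 'I_(p + q)) :=
  match split t with inl i => [forall j, D i j == 0] | inr _ => false end.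
have [r [rho [e [[e' eK e'K] fe]]]] := ordinal_sort f.
have e_inj : injective e by exact: can_inj eK.
exists r, rho, (\matrix_(j, x) b (e j) x), (\matrix_(x, j) c x (e j)).
have n_eq : n = (r + rho)%N.
  rewrite -[in LHS](card_ord n) -(cardsC F) addnC -/p -/q -(card_ord (p + q)).
  by rewrite -(bij_eq_card (Bijective eK e'K)) card_ord.
have coordE (a : 'rV_n) j :
    (a *m rsubmx (\matrix_(x, j0) c x (e j0))) 0 j = (a *m c) 0 (e (rshift r j)).
  by rewrite !mxE; apply: eq_bigr => x _; rewrite !mxE.
split=> //.
- apply/matrixP => i j; have := congr1 (fun M : 'M_(_, _) => M (e i) (e j)) bc.
  rewrite /mulmx !mxE (inj_eq e_inj) => <-.
  by apply: eq_bigr => x _; rewrite !mxE.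
- rewrite -cb; apply/matrixP => x y; rewrite !mxE [RHS](reindex e) /=.
    by apply: eq_bigr => j _; rewrite !mxE.
  exact: onW_bij (Bijective eK e'K).
- move=> a.
  have ac0 : a *m rsubmx (\matrix_(x, j0) c x (e j0)) = 0 <->
      forall t, ~~ f t -> (a *m c) 0 t = 0.
    split=> [h t ft|h].
      have := fe (e' t); rewrite e'K (negbTE ft) => /esym/negbT.
      rewrite -leqNgt => rt; have tr : (e' t - r < rho)%N by rewrite ltn_subLR.
      have -> : t = e (rshift r (Ordinal tr)).
        rewrite -[LHS]e'K; congr e; apply: val_inj; rewrite /= subnKC //.
      by rewrite -coordE h mxE.
    apply/rowP => j; rewrite coordE [RHS]mxE; apply: h.
    by rewrite fe /= -leqNgt leq_addr.
  rewrite ac0 /c mul_mx_row.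
  have aK s : (a *m K^T) 0 s = a 0 (ka s).
    rewrite mxE (bigD1 (ka s)) //= big1 ?addr0 => [|x xs].
      by rewrite !mxE eqxx mulr1.
    by rewrite !mxE eq_sym (negbTE xs) mulr0.
  have aF0 : (forall i, i \in F -> a 0 i = 0) <-> forall s, (a *m K^T) 0 s = 0.
    split=> [h s|h i /kaP[s <-]]; first by rewrite aK h.
    by rewrite -aK.
  pose v := a *m S^T *m L.
  have aA : (forall i, i \in F -> a 0 i = 0) -> a *m A = v *m D *m R.
    move=> /aF0 h; have aK0 : a *m K^T = 0 by apply/rowP => s; rewrite h mxE.
    rewrite /v -[in LHS](mulmx1 a) -SSKK mulmxDr [X in _ + X]mulmxA aK0 mul0mx addr0.
    by rewrite -!mulmxA SA !mulmxA.
  have vD j : (v *m D) 0 j = \sum_i v 0 i * D i j by rewrite mxE.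
  rewrite mulmxA -/v; split=> [h|[a0 aF] t].
    have aF i : i \in F -> a 0 i = 0.
      move: i; apply/aF0 => s; rewrite -(row_mxEr v); apply: h.
      by rewrite /f (unsplitK (inr s)).
    split=> //; rewrite aA // (_ : v *m D = 0) ?mul0mx //.
    apply/rowP => j; rewrite vD [RHS]mxE big1 // => i _.
    have [/forallP/(_ j)/eqP->|Di] := boolP [forall j, D i j == 0].
      by rewrite mulr0.
    have := h (lshift q i); rewrite /f (unsplitK (inl i)) => /(_ Di).
    by rewrite row_mxEl => ->; rewrite mul0r.
  have vD0 : v *m D = 0.
    by rewrite -[LHS]mulmx1 -(mulmxV Ru) mulmxA -aA // a0 mul0mx.
  case: (split_ordP t) => [i ->|s ->].
    rewrite /f (unsplitK (inl i)) negb_forall => /existsP[j Dij].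
    have ij : i = j :> nat by apply/eqP; apply: contraNT Dij => ij; rewrite mxE (negbTE ij).
    have := vD j; rewrite vD0 mxE (bigD1 i) //= big1 => [|i' ii'].
      by rewrite addr0 row_mxEl => /esym/eqP; rewrite mulf_eq0 (negbTE Dij) orbF => /eqP.
    have {}ii' : (i' == i :> nat) = false by exact/negbTE.
    by rewrite [D _ _]mxE -ij ii' mulr0.
  by move=> _; rewrite row_mxEr; exact: (aF0.1 aF).
split=> [i iF|j].
  have [s sx] := kaP i iF; pose t := e' (rshift p s).
  have et : e t = rshift p s by rewrite /t e'K.
  have := fe t; rewrite et /f (unsplitK (inr s)) => /esym/negbT.
  rewrite -leqNgt => rt; have tr : (t - r < rho)%N by rewrite ltn_subLR.
  exists (Ordinal tr); have -> : rshift r (Ordinal tr) = t.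
    by apply: val_inj; rewrite /= subnKC.
  by apply/rowP => x; rewrite [LHS]mxE [LHS]mxE et col_mxEd [K _ _]mxE [RHS]mxE sx eqxx eq_sym.
case: (split_ordP (e j)) => [i ej|s ej].
  right=> x xF; rewrite mxE ej col_mxEu mxE big1 // => l _; rewrite !mxE.
  by case: eqP => [lx|]; rewrite ?mulr0 //; rewrite -lx ioF in xF.
left; exists (ka s) => //.
by apply/rowP => x; rewrite [LHS]mxE [LHS]mxE ej col_mxEd [K _ _]mxE [RHS]mxE eqxx eq_sym.
Qed.

(** * Transversality of the candidate *)

Section LaurentIdomain.
Variables (k : fieldType) (d : nat).
Local Notation L := (laurent k d).

Definition laurent_unit : {pred L} := fun p => `[< invertible p >].

Definition laurent_inv (p : L) : L :=
  if pselect (invertible p) is left pu then projT1 (cid pu) else p.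

Lemma laurent_mulVx : {in laurent_unit, left_inverse 1 laurent_inv *%R}.
Proof.
move=> p /asboolP pu; rewrite /laurent_inv; case: pselect => // {}pu.
by case: cid => q /=; rewrite mulrC.
Qed.

Lemma laurent_unitPl (p q : L) : q * p = 1 -> p \in laurent_unit.
Proof. by rewrite mulrC => pq; apply/asboolP; exists q. Qed.

Lemma laurent_inv_out : {in [predC laurent_unit], laurent_inv =1 id}.
Proof.
by move=> p /asboolPn pu; rewrite /laurent_inv; case: pselect.
Qed.

HB.instance Definition _ := GRing.ComNzRing_hasMulInverse.Build L
  laurent_mulVx laurent_unitPl laurent_inv_out.

Lemma laurent_mulf_eq0 : GRing.integral_domain_axiom L.
Proof. by move=> p q /laurent_integral[] ->; rewrite eqxx ?orbT. Qed.

HB.instance Definition _ := GRing.ComUnitRing_isIntegral.Build L laurent_mulf_eq0.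
End LaurentIdomain.

(* The localization of R at a prime, inside the fractions of a domain D.      *)
Section LocalRing.
Variables (D : idomainType) (R : comNzRingType) (v : {rmorphism R -> D}).
Variable M : R -> Prop.
Hypotheses (v_inj : injective v) (primeM : prime_ideal M).

Definition loc_pred of injective v & prime_ideal M : {pred {fraction D}} :=
  fun x => `[< exists a s, ~ M s /\ x * tofrac (v s) = tofrac (v a) >].
Local Notation LP := (loc_pred v_inj primeM).

Lemma loc_predP x :
  reflect (exists a s, ~ M s /\ x * tofrac (v s) = tofrac (v a)) (x \in LP).
Proof. exact: asboolP. Qed.

Lemma loc_subring_closed : subring_closed LP.
Proof.
have [_ M1 Mp] := primeM.
split=> [|x y /loc_predP[a [s [ns xs]]] /loc_predP[b [t [nt yt]]]
  |x y /loc_predP[a [s [ns xs]]] /loc_predP[b [t [nt yt]]]]; apply/loc_predP.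
- by exists 1, 1; rewrite !rmorph1 mulr1.
- exists (a * t - b * s), (s * t); split; first by move=> /Mp[].
  by rewrite rmorphB !rmorphM tofracB !tofracM -xs -yt; ring.
exists (a * b), (s * t); split; first by move=> /Mp[].
by rewrite [v (s * t)]rmorphM [v (a * b)]rmorphM !tofracM -xs -yt; ring.
Qed.

HB.instance Definition _ := GRing.isSubringClosed.Build {fraction D} LP
  loc_subring_closed.

Record locring (h1 : injective v) (h2 : prime_ideal M) : Type :=
  LocRing {loc_val : {fraction D}; loc_valP : loc_val \in loc_pred h1 h2}.
Local Notation O := (locring v_inj primeM).
HB.instance Definition _ := [isSub for @loc_val v_inj primeM].
HB.instance Definition _ := [Choice of O by <:].
HB.instance Definition _ := [SubChoice_isSubComNzRing of O by <:].

Lemma loc_val_zmod : zmod_morphism (@loc_val v_inj primeM).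
Proof. by []. Qed.
Lemma loc_val_monoid : monoid_morphism (@loc_val v_inj primeM).
Proof. by []. Qed.
HB.instance Definition _ := GRing.isZmodMorphism.Build O {fraction D}
  (@loc_val v_inj primeM) loc_val_zmod.
HB.instance Definition _ := GRing.isMonoidMorphism.Build O {fraction D}
  (@loc_val v_inj primeM) loc_val_monoid.

Lemma loc_of_proof a : tofrac (v a) \in LP.
Proof.
have [_ M1 _] := primeM.
by apply/loc_predP; exists a, 1; rewrite !rmorph1 mulr1.
Qed.

Definition loc_of a : O := LocRing (loc_of_proof a).

Lemma loc_of_zmod : zmod_morphism loc_of.
Proof. by move=> a b; apply: val_inj; rewrite /= !rmorphB. Qed.
Lemma loc_of_monoid : monoid_morphism loc_of.
Proof. by split=> [|a b]; apply: val_inj; rewrite /= ?rmorph1 ?rmorphM. Qed.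
HB.instance Definition _ := GRing.isZmodMorphism.Build R O loc_of loc_of_zmod.
HB.instance Definition _ := GRing.isMonoidMorphism.Build R O loc_of loc_of_monoid.

Lemma loc_of_localization : is_localization_at M loc_of.
Proof.
have [[M0 _ _] M1 Mp] := primeM.
have nz s : ~ M s -> tofrac (v s) != 0.
  move=> ns; rewrite tofrac_eq0; apply/eqP => vs0; apply: ns.
  by rewrite (_ : s = 0) //; apply: v_inj; rewrite vs0 rmorph0.
split.
- move=> s ns; have sP : (tofrac (v s))^-1 \in LP.
    apply/loc_predP; exists 1, s; split=> //.
    by rewrite mulVf ?nz // !rmorph1.
  exists (LocRing sP); apply: val_inj; rewrite /= divff ?nz //.
- move=> [x hx]; have /loc_predP[a [s [ns xs]]] := hx.
  by exists a, s; split=> //; apply: val_inj.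
move=> a la; exists 1; split=> //; rewrite mul1r; apply: v_inj; rewrite rmorph0.
by apply/eqP; rewrite -tofrac_eq0; have := congr1 (@loc_val _ _) la => /= ->.
Qed.
End LocalRing.

(** * Monomials of W at a prime ideal *)

Section PrimeMonomials.
Variables (k : fieldType) (n : nat) (E : {set 'I_n}).
Local Notation W := (taffine k E).
Variable M : W -> Prop.
Hypothesis primeM : prime_ideal M.

Lemma delta_nonneg (F : {set 'I_n}) i : nonneg_on F (delta_mx 0 i).
Proof. by move=> j _; rewrite mxE; case: (_ && _). Qed.

Lemma taffine_varE i : taffine_var k E i = tmon k E (delta_mx 0 i).
Proof. by apply: val_inj; rewrite /= val_tmon //; exact: delta_nonneg. Qed.

Definition vanishing_vars : {set 'I_n} :=
  [set i in E | `[< M (taffine_var k E i) >]].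
Local Notation F' := vanishing_vars.

Lemma vanishing_varsP i : reflect (i \in E /\ M (taffine_var k E i)) (i \in F').
Proof. by rewrite inE; apply: (iffP andP) => -[iE /asboolP]. Qed.

Lemma prime_tmon_mem m i : nonneg_on E m -> i \in F' -> m 0 i != 0 -> M (tmon k E m).
Proof.
move=> hm /vanishing_varsP[iE Mi] mi; have [[_ _ MM] _ _] := primeM.
rewrite -(subrK (delta_mx 0 i) m) tmonD; last exact: delta_nonneg.
  by rewrite -taffine_varE; apply: MM.
move=> j jE; rewrite !mxE /=; case: eqP => [->|_]; last by rewrite subr0 hm.
by rewrite subr_ge0 -gtz0_ge1 lt_neqAle eq_sym mi hm.
Qed.

(** The monomial is a product of variables outside E, which are units in W together with their
    inverses, and of variables of E that are not in the prime M. *)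
Lemma prime_tmon_notin m : nonneg_on E m -> (forall i, i \in F' -> m 0 i = 0) ->
  ~ M (tmon k E m).
Proof.
move=> hm m0; have [[M0 MD MM] M1 Mp] := primeM.
pose K a := nonneg_on E a /\ ~ M (tmon k E a).
suff [] : K (\sum_i m 0 i *: delta_mx 0 i) by rewrite -row_sum_delta.
elim/big_ind: _ => [|a b [ha na] [hb nb]|i _].
- by split; [exact: nonneg_on0|rewrite tmon0].
- by split; [exact: nonneg_onD|rewrite tmonD // => /Mp[]].
have [iE|iE] := boolP (i \in E); last first.
  have hi (z : int) : nonneg_on E (z *: delta_mx 0 i).
    move=> j jE; rewrite !mxE /=; case: eqP jE => [->|_ _]; last by rewrite mulr0.
    by rewrite (negbTE iE).
  split=> // Mz; apply: M1; rewrite -(tmon0 k E) -(addNr (m 0 i *: delta_mx 0 i)).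
  by rewrite -scaleNr tmonD //; apply: MM.
have mi : m 0 i = (`|m 0%R i|%N : int) by have := hm i iE; lia.
have -> : m 0 i *: delta_mx 0 i = delta_mx 0 i *+ `|m 0%R i|%N :> 'rV[int]_n.
  by rewrite [X in X *: _]mi -scaler_nat natz.
split; first by move=> j jE; rewrite mulmxnE mulrn_wge0 //; apply: delta_nonneg jE.
rewrite tmonMn; last exact: delta_nonneg.
rewrite -taffine_varE; have [iF|iF] := boolP (i \in F').
  by rewrite (m0 _ iF) absz0 expr0.
elim: `|_|%N => [|N IHN]; first by rewrite expr0.
by rewrite exprS => /Mp[Mi|//]; case/negP: iF; apply/vanishing_varsP.
Qed.

Lemma taffine_val_inj : injective (@taffine_val k n E).
Proof. exact: val_inj. Qed.

Definition taffine_loc : comNzRingType :=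
  locring (v := (@taffine_val k n E : {rmorphism _ -> _})) taffine_val_inj primeM.
Local Notation O := taffine_loc.

Definition to_taffine_loc : {rmorphism W -> O} :=
  loc_of (v := (@taffine_val k n E : {rmorphism _ -> _})) taffine_val_inj primeM.
Local Notation l := to_taffine_loc.

Lemma to_taffine_locP : is_localization_at M l.
Proof. exact: loc_of_localization. Qed.

Lemma taffine_loc_local : is_ideal (fun x : O => ~ invertible x).
Proof. exact: localization_local primeM to_taffine_locP. Qed.
End PrimeMonomials.

Section LocalMonomials.
Variables (k : fieldType) (n : nat) (E : {set 'I_n}).
Local Notation W := (taffine k E).
Variable M : W -> Prop.
Hypothesis primeM : prime_ideal M.
Local Notation F := (vanishing_vars M).
Local Notation O := (taffine_loc primeM).
Local Notation l := (to_taffine_loc primeM).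
Implicit Types a b m : 'rV[int]_n.

(** For b nonnegative on F only variables that are nonzero at the point get inverted, so x^b lies in
    the local ring ([val_lmonom]). Otherwise the default 0 may appear. *)
Definition lmonom b : O := insubd 0 (tofrac (lterm 1 b : laurent k n)).

(** The exponent of a monomial that is a unit at the point and, for b nonnegative on F, brings x^b
    into W. *)
Definition clear_denom b : 'rV[int]_n :=
  \row_i (if i \in F then 0 else `|b 0 i|).

Lemma clear_denom_nonneg b : nonneg_on E (clear_denom b).
Proof. by move=> i _; rewrite mxE; case: ifP. Qed.

Lemma clear_denom_notin b : ~ M (tmon k E (clear_denom b)).
Proof.
apply: prime_tmon_notin => // [|i iF]; first exact: clear_denom_nonneg.
by rewrite mxE iF.
Qed.

Lemma add_clear_denom_nonneg b : nonneg_on F b -> nonneg_on E (b + clear_denom b).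
Proof.
move=> hb i _; rewrite mxE [clear_denom b 0 i]mxE.
case: ifP => [/hb|_]; first by rewrite addr0.
by rewrite addrC -lerBlDr sub0r -normrN; exact: ler_norm.
Qed.

Lemma val_lmonom b : nonneg_on F b ->
  loc_val (lmonom b) = tofrac (lterm 1 b : laurent k n).
Proof.
move=> hb; apply: (@insubdK _ _ O).
apply/(loc_predP (@taffine_val_inj k n E) primeM).
exists (tmon k E (b + clear_denom b)), (tmon k E (clear_denom b)).
split; first exact: clear_denom_notin.
rewrite /= !val_tmon; [|exact: add_clear_denom_nonneg|exact: clear_denom_nonneg].
by rewrite -tofracM ltermM mulr1.
Qed.

Lemma lmonomE m : nonneg_on E m -> l (tmon k E m) = lmonom m.
Proof.
move=> hm; apply: val_inj; rewrite /= val_lmonom ?val_tmon //.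
by move=> i /vanishing_varsP[/hm].
Qed.

Lemma lmonom0 : lmonom 0 = 1.
Proof. by rewrite -lmonomE ?tmon0 ?rmorph1 //; exact: nonneg_on0. Qed.

Lemma lmonomD a b : nonneg_on F a -> nonneg_on F b ->
  lmonom (a + b) = lmonom a * lmonom b.
Proof.
move=> ha hb; apply: val_inj; rewrite /= !val_lmonom //; last exact: nonneg_onD.
by rewrite -tofracM ltermM mulr1.
Qed.

Definition zero_on m := forall i, i \in F -> m 0 i = 0.

Lemma zero_onW m : zero_on m -> nonneg_on F m.
Proof. by move=> hm i iF; rewrite hm. Qed.

Lemma zero_onN m : zero_on m -> zero_on (- m).
Proof. by move=> hm i iF; rewrite mxE hm ?oppr0. Qed.

Lemma zero_onD a b : zero_on a -> zero_on b -> zero_on (a + b).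
Proof. by move=> ha hb i iF; rewrite mxE ha ?hb ?addr0. Qed.

Lemma zero_on0 : zero_on 0.
Proof. by move=> i iF; rewrite mxE. Qed.

Lemma lmonom_inv b : zero_on b -> lmonom b * lmonom (- b) = 1.
Proof.
move=> hb; rewrite -lmonomD ?subrr ?lmonom0 //; apply: zero_onW => //.
exact: zero_onN.
Qed.

Lemma lmonomMn b N : nonneg_on F b -> lmonom (b *+ N) = lmonom b ^+ N.
Proof.
move=> hb; have hN N' : nonneg_on F (b *+ N').
  by move=> i iE; rewrite mulmxnE mulrn_wge0 ?hb.
elim: N => [|N IHN]; first by rewrite mulr0n lmonom0.
by rewrite mulrS lmonomD // IHN exprS.
Qed.

Lemma lmonom_sum (T : finType) (f : T -> 'rV[int]_n) :
  (forall t, nonneg_on F (f t)) ->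
  nonneg_on F (\sum_t f t) /\ lmonom (\sum_t f t) = \prod_t lmonom (f t).
Proof.
move=> hf; elim/big_rec2: _ => [|t x b _ [hb bx]].
  by split; [exact: nonneg_on0|exact: lmonom0].
by split; [exact: nonneg_onD|rewrite lmonomD // bx].
Qed.

Lemma lmonom_comb (T : finType) (f : T -> 'rV[int]_n) (c : T -> int) :
  (forall t, nonneg_on F (f t)) -> (forall t, 0 <= c t) ->
  lmonom (\sum_t c t *: f t) = \prod_t lmonom (f t) ^+ `|c t|.
Proof.
move=> hf hc.
have cE t : c t *: f t = f t *+ `|c t|.
  by rewrite -scaler_nat natz gez0_abs.
rewrite (lmonom_sum _).2 => [|t]; last first.
  by rewrite cE => i iF; rewrite mulmxnE mulrn_wge0 ?hf.
by apply: eq_bigr => t _; rewrite cE lmonomMn.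
Qed.

(** Up to a unit of the local ring, x^b - 1 is a binomial of W. This links the equations z_j = 1
    with the ideal of V. *)
Lemma lmonom_minus1 b : zero_on b ->
  (lmonom b - 1) * l (tmon k E (clear_denom b))
  = l (tmon k E (b + clear_denom b) - tmon k E (clear_denom b)).
Proof.
move=> hb; rewrite rmorphB mulrBl mul1r; congr (_ - _).
have h1 := clear_denom_nonneg b.
have h2 : nonneg_on E (b + clear_denom b).
  by apply/add_clear_denom_nonneg/zero_onW.
rewrite !lmonomE // -lmonomD //; first exact: zero_onW.
by move=> i /vanishing_varsP[/h1].
Qed.
End LocalMonomials.

Section RingIdentities.
Variable R : comNzRingType.
Implicit Types x y u v s t : R.
Lemma mul_sub1 x y : x * y - 1 = x * (y - 1) + (x - 1).
Proof. by ring. Qed.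
Lemma inv_sub1 x y : y - 1 = - y * (x - 1) + (x * y - 1).
Proof. by ring. Qed.
Lemma mul_interchange s t u v x : t * u * (x * s * v) = x * (s * t) * (v * u).
Proof. by ring. Qed.
End RingIdentities.

(** * Transversality of a subtorus closure at its closed points *)

Section SubtorusTransversal.
Variables (k : fieldType) (r rho : nat).
Local Notation n := (r + rho)%N.
Variables (E F : {set 'I_n}) (B C : 'M[int]_n).
Hypotheses (BC : B *m C = 1%:M) (CB : C *m B = 1%:M).
Local Notation P := (rsubmx C).
Local Notation Q := (dsubmx B).
Local Notation W := (taffine k E).
Local Notation iV := (subtorus_proj k E P).
Hypothesis kerPF : forall a : 'rV_n, a *m P = 0 -> forall i, i \in F -> a 0 i = 0.
Hypothesis rowF : forall i, i \in F -> exists j, row (rshift r j) B = delta_mx 0 i.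
Hypothesis rowB : forall j, (exists2 i, i \in F & row j B = delta_mx 0 i) \/
                   (forall i, i \in F -> B j i = 0).
Hypothesis faceF : forall G, is_face P E G -> G \subset F.

Section AtPoint.
Variable M : W -> Prop.
Hypotheses (primeM : prime_ideal M) (VM : forall w, ideal_of iV w -> M w).
Local Notation G := (vanishing_vars M).
Local Notation O := (taffine_loc primeM).
Local Notation l := (to_taffine_loc primeM).
Local Notation z := (@lmonom k n E M primeM).
Local Notation mO x := (~ invertible (x : O)).
Let localO := taffine_loc_local primeM.

Lemma tmon_sub_ideal a b : nonneg_on E a -> nonneg_on E b -> (a - b) *m P = 0 ->
  ideal_of iV (tmon k E a - tmon k E b).
Proof.
move=> ha hb; rewrite mulmxBl => /eqP; rewrite subr_eq0 => /eqP ab.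
by apply/subtorus_proj_ker; rewrite lmon_tmonB // ab subrr.
Qed.

(** If a were in the lattice, nonnegative on G and positive at some i in G, then x^(a+) would be in
    M and x^(a-) would not, although their difference vanishes on V. *)
Lemma vanishing_face : is_face P E G.
Proof.
split=> [|a aP a0 i iG]; first by apply/subsetP => i /vanishing_varsP[].
apply/eqP; rewrite eq_le a0 // andbT leNgt; apply/negP => ai.
pose u := pos_part a; pose w := pos_part (- a).
have hu : nonneg_on E u by exact: pos_part_nonneg.
have hw : nonneg_on E w by exact: pos_part_nonneg.
have /VM Muw : ideal_of iV (tmon k E u - tmon k E w).
  by apply/subtorus_proj_ker; exact: lmon_pos_part.
have [hM _ _] := primeM; have [_ MD _] := hM.
apply: (prime_tmon_notin primeM hw) => [j jG|].
  by have := a0 _ jG; rewrite !mxE; move: (a 0 j) => x; case: ifP; lia.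
rewrite -[tmon k E w](subKr (tmon k E u)); apply: idealB => //.
apply: (prime_tmon_mem primeM hu iG); rewrite mxE.
by move: ai; move: (a 0 i) => x; case: ifP; lia.
Qed.

Let subGF : G \subset F.
Proof. exact/faceF/vanishing_face. Qed.

Lemma row_alt j : (exists2 i, i \in G & row j B = delta_mx 0 i) \/ zero_on M (row j B).
Proof.
case: (rowB j) => [[i iF rj]|rj]; last first.
  by right=> i iG; rewrite mxE rj // (subsetP subGF).
have [iG|iG] := boolP (i \in G); first by left; exists i.
by right=> x xG; rewrite rj mxE /=; case: eqP => // xi; rewrite -xi xG in iG.
Qed.

Let row_nonneg j : nonneg_on G (row j B).
Proof.
by case: (row_alt j) => [[i iG ->]|/zero_onW//]; exact: delta_nonneg.
Qed.

Lemma row_kerP (j : 'I_r) : row (lshift rho j) B *m P = 0.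
Proof.
rewrite -row_mul; apply/rowP => x; rewrite mxE [RHS]mxE.
have := congr1 (fun A : 'M_n => A (lshift rho j) (rshift r x)) BC.
rewrite [RHS]mxE eq_lrshift => h; apply: etrans h.
by rewrite !mxE; apply: eq_bigr => y _; rewrite !mxE.
Qed.

Lemma row_kerP_zero (j : 'I_r) : zero_on M (row (lshift rho j) B).
Proof. by move=> i /(subsetP subGF); apply: kerPF; exact: row_kerP. Qed.

Let lcoef : {rmorphism k -> O} := l \o in_alg W.

Let base (x : O) : Prop := exists c, x = lcoef c.

Let base_subring : subring_like base.
Proof.
split; first by exists 1; rewrite rmorph1.
  by move=> _ _ [c ->] [c' ->]; exists (c - c'); rewrite rmorphB.
by move=> _ _ [c ->] [c' ->]; exists (c * c'); rewrite rmorphM.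
Qed.

Let base_local a : base a -> mO a -> a = 0.
Proof.
move=> [c ->] hc; have [->|c0] := eqVneq c 0; first by rewrite rmorph0.
by case: hc; exists (lcoef c^-1); rewrite -rmorphM divff // rmorph1.
Qed.

Let lZ c w : l (c *: w) = lcoef c * l w.
Proof. by rewrite /= -[in RHS]rmorphM mulr_algl. Qed.

(* Exponent of the product of the invertible monomials of the basis: a power  *)
(* of it clears the negative exponents of an element of W.                    *)
Let U : 'rV[int]_n := \sum_(j | `[< zero_on M (row j B) >]) row j B.

Let U_zero : zero_on M U.
Proof.
rewrite /U; elim/big_ind: _ => [||j /asboolP//]; first exact: zero_on0.
exact: zero_onD.
Qed.

(** In the basis B, a coordinate of m can be negative only along rows that vanish on G, and N copies
    of U make it nonnegative. Allowing every N above N0 lets sums share the exponent. *)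
Let generated w : exists N0, forall N, (N0 <= N)%N ->
  forall A : O -> Prop, subring_like A -> (forall a, base a -> A a) ->
  (forall j, A (z (row j B))) -> A (l w * z U ^+ N).
Proof.
elim/taffine_ind: w => [v w [N1 h1] [N2 h2]|c m hm].
  exists (maxn N1 N2) => N; rewrite geq_max => /andP[le1 le2] A hA hb hz.
  rewrite rmorphD mulrDl; apply: subring_likeD => //; first exact: (h1 N).
  exact: (h2 N).
have mG : nonneg_on G m by move=> i /vanishing_varsP[/hm].
exists (\sum_j `|(m *m C) 0%R j|)%N => N hN A hA hb hz; have [_ _ AM] := hA.
rewrite lZ -mulrA; apply: (AM); first by apply: hb; exists c.
rewrite lmonomE // -lmonomMn; last exact: zero_onW.
have UN : zero_on M (U *+ N) by move=> i iG; rewrite mulmxnE U_zero // mul0rn.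
rewrite -lmonomD //; last exact: zero_onW.
pose c' j : int := (m *m C) 0 j + (if `[< zero_on M (row j B) >] then N%:Z else 0).
have -> : m + U *+ N = \sum_j c' j *: row j B.
  rewrite -{1}[m]mulmx1 -CB mulmxA mulmx_sum_row /c' /U.
  under [RHS]eq_bigr => j _ do rewrite scalerDl.
  rewrite big_split /=; congr (_ + _).
  rewrite -sumrMnl big_mkcond /=; apply: eq_bigr => j _.
  by case: ifP => _; rewrite ?scale0r // -scaler_nat natz.
rewrite lmonom_comb //; last first.
  move=> j; rewrite /c'; case: asboolP => [_|nz].
    have : (`|(m *m C) 0%R j| <= N)%N.
      by apply: leq_trans hN; rewrite (bigD1 j) //= leq_addr.
    move: (_ 0 j) => x; lia.
  (* This row is the unit vector of some i in G and all other rows vanish at i, so the coordinate of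
     m is m_i. *)
  case: (row_alt j) => // -[i iG rj]; rewrite addr0.
  have := mG _ iG; rewrite -{1}[m]mulmx1 -CB mulmxA mxE (bigD1 j) //= big1 => [|j' jj'].
    by have := congr1 (fun x : 'rV_n => x 0 i) rj; rewrite !mxE !eqxx => ->; rewrite addr0 mulr1.
  suff -> : B j' i = 0 by rewrite mulr0.
  case: (row_alt j') => [[i' i'G rj']|/(_ i iG)]; last by rewrite mxE.
  have -> : B j' i = row j' B 0 i by rewrite mxE.
  rewrite rj' mxE eqxx /=; case: eqP => // ii'.
  have : row j' (B *m C) = row j (B *m C) by rewrite !row_mul rj rj' ii'.
  move=> /(congr1 (fun x : 'rV_n => x 0 j)); rewrite BC !mxE eqxx.
  by rewrite (negbTE jj').
elim/big_ind: _ => //; first by case: hA.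
by move=> j _; apply: subring_likeX.
Qed.

Let J : O -> Prop :=
  ideal_span (fun t => exists i : 'I_r, t = z (row (lshift rho i) B) - 1).
Let J_ideal : is_ideal J. Proof. exact: ideal_span_ideal. Qed.

(** The exponents b that vanish on G and have z^b - 1 in J form a group, which contains the first r
    rows of B. *)
Let relation (c : 'rV[int]_r) :
  zero_on M (c *m usubmx B) /\ J (z (c *m usubmx B) - 1).
Proof.
have [J0 JD JM] := J_ideal.
pose K b := zero_on M b /\ J (z b - 1).
have K0 : K 0 by split; [exact: zero_on0|rewrite lmonom0 subrr].
have KD a b : K a -> K b -> K (a + b).
  move=> [a0 Ja] [b0 Jb]; split; first exact: zero_onD.
  rewrite lmonomD; [|exact: zero_onW|exact: zero_onW].
  by rewrite mul_sub1; apply: JD => //; apply: JM.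
have KN a : K a -> K (- a).
  move=> [a0 Ja]; split; first exact: zero_onN.
  by rewrite (inv_sub1 (z a)) lmonom_inv // subrr addr0; apply: JM.
rewrite mulmx_sum_row; elim/big_ind: _ => // i _.
have -> : row i (usubmx B) = row (lshift rho i) B by apply/rowP => x; rewrite !mxE.
have Ki : K (row (lshift rho i) B).
  split; first exact: row_kerP_zero.
  by apply: mem_ideal_span; exists i.
have Kn N : K (N%:Z *: row (lshift rho i) B).
  by elim: N => [|N IHN]; [rewrite scale0r|rewrite intS scalerDl scale1r; apply: KD].
case: (c 0 i) => N; first exact: Kn.
by rewrite NegzE scaleNr; apply/KN/Kn.
Qed.

(** The projection m -> mPQ along the first r rows of B, carried to functions. It kills the ideal of
    V because it factors through [lmon P]. *)
Let section_map : exists h : W -> O, [/\ {morph h : v w / v + w},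
  forall c m, nonneg_on E m -> h (c *: tmon k E m) = lcoef c * z (m *m P *m Q) &
  forall w, ideal_of iV w -> h w = 0].
Proof.
pose h' : laurent k rho -> O := leval lcoef (fun c => z (c *m Q)).
exists (fun w => h' (lmon P (taffine_val w))); split.
- move=> v w; apply: etrans (congr1 h' (lmonD P (taffine_val v) (taffine_val w))) _.
  exact: levalD.
- move=> c m hm; apply: etrans (congr1 (fun p => h' (lmon P p)) (val_tmonZ c hm)) _.
  apply: etrans (congr1 h' (lmon_lterm P c m)) _; exact: leval_lterm.
move=> w /subtorus_proj_ker w0; apply: etrans (congr1 h' w0) _; exact: leval0.
Qed.

(** Each x^m is its image under the projection times a monomial congruent to 1 modulo J. *)
Let mod_relations w : ideal_of iV w -> J (l w).
Proof.
have [J0 JD JM] := J_ideal; have [h [hD hmon hV]] := section_map.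
move=> /hV hw; rewrite -[l w]subr0 -hw {hw}.
elim/taffine_ind: w => [v w hv hw|c m hm].
  by rewrite hD rmorphD opprD addrACA; apply: JD.
have mG : nonneg_on G m by move=> i /vanishing_varsP[/hm].
have mE : m = m *m lsubmx C *m usubmx B + m *m P *m Q.
  rewrite -!mulmxA -mulmxDr -mul_row_col hsubmxK vsubmxK CB mulmx1 //.
have [z0 Jz] := relation (m *m lsubmx C).
have mQ : nonneg_on G (m *m P *m Q).
  move=> i iG; have := mG _ iG; rewrite {1}mE mxE z0 // add0r //.
rewrite hmon // lZ lmonomE // {1}mE.
rewrite lmonomD //; last exact: zero_onW.
rewrite -mulrBr -[X in _ - X]mul1r -mulrBl; apply: (JM); rewrite mulrC.
exact: JM.
Qed.

(** The values prescribed at the point: 1 for the equations of V, 0 for the hypersurfaces of E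
    through the point. [None] leaves the choice of a parameter to [tower_parameters]. *)
Let special (j : 'I_n) : option O :=
  if (j < r)%N then Some 1
  else if [exists i in G, row j B == delta_mx 0 i] then Some 0 else None.

Lemma subtorus_transversal_at :
  transversal_at E (taffine_var k E) (ideal_of iV) M.
Proof.
have locM := to_taffine_locP primeM.
have nonunitM := localization_nonunit primeM locM.
exists O, l; split; first exact: locM.
have specialP j a : special j = Some a -> base a /\ mO (z (row j B) - a).
  rewrite /special; case: ifP => [jr [<-]|_].
    split; first by exists 1; rewrite rmorph1.
    have -> : j = lshift rho (Ordinal jr) by exact: val_inj.
    set b := row _ _ => ub; have b0 : zero_on M b by exact: row_kerP_zero.
    have : invertible (l (tmon k E (b + clear_denom M b) - tmon k E (clear_denom M b))).
      rewrite -lmonom_minus1 //; apply: invertible_mul => //.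
      by apply: contrapT => /nonunitM; exact: clear_denom_notin.
    have /VM/nonunitM nu : ideal_of iV
        (tmon k E (b + clear_denom M b) - tmon k E (clear_denom M b)).
      apply: tmon_sub_ideal; [exact/add_clear_denom_nonneg/zero_onW|exact: clear_denom_nonneg|].
      by rewrite addrK row_kerP.
    exact: nu.
  case: ifP => // /exists_inP[i iG /eqP rj] [<-]; split; first by exists 0; rewrite rmorph0.
  rewrite subr0 rj -lmonomE; last exact: delta_nonneg.
  by rewrite -taffine_varE; apply/nonunitM; case/vanishing_varsP: iG.
have [y [ysp my yspan]] := tower_parameters localO base_subring base_local specialP.
have yJ (i : 'I_r) : y (lshift rho i) = z (row (lshift rho i) B) - 1.
  by apply: ysp; rewrite /special /= ltn_ord.
exists y, r; split; first exact: leq_addr.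
- move=> x; split; first by apply: (ideal_span_sub localO) => _ [i ->].
  move=> mx; set I := ideal_span _; have [I0 ID IM] : is_ideal I by exact: ideal_span_ideal.
  have [_ [_ frac _]] := (I, locM); have [a [s [ns xs]]] := frac x.
  have [s' ss'] : invertible (l s) by apply: contrapT => /nonunitM.
  have [N0 hN] := generated a.
  have uU : zero_on M (U *+ N0) by move=> i iG; rewrite mulmxnE U_zero // mul0rn.
  have uUE : z U ^+ N0 = z (U *+ N0) by rewrite lmonomMn //; exact: zero_onW.
  (* Up to units x becomes a polynomial in the z_j, to which [yspan] applies. *)
  have Ia : I (l a * z U ^+ N0).
    apply: yspan => [ua|A hA hb hz]; last exact: hN hA hb hz.
    by apply: mx; move/invertible_mull: ua; rewrite -xs; exact: invertible_mull.
  have -> : x = (s' * z (- (U *+ N0))) * (l a * z U ^+ N0).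
    have e1 := lmonom_inv primeM uU; rewrite uUE -xs.
    by rewrite mul_interchange ss' e1 !mulr1.
  exact: IM.
- have JE x : J x <-> ideal_span (fun t => exists2 i : 'I_n, (i < r)%N & t = y i) x.
    split; apply: ideal_span_sub; try exact: ideal_span_ideal.
      move=> _ [i ->]; apply: mem_ideal_span; exists (lshift rho i); first exact: (ltn_ord i).
      by rewrite yJ.
    move=> _ [i ir ->]; apply: mem_ideal_span; exists (Ordinal ir).
    by rewrite -yJ; congr y; apply: val_inj.
  move=> x; rewrite -JE; split; apply: ideal_span_sub => //.
  - by move=> _ [a /mod_relations Ja ->].
  - exact: ideal_span_ideal.
  move=> _ [i ->]; set b := row _ _; have b0 : zero_on M b by exact: row_kerP_zero.
  have [_ _ IM] := ideal_span_ideal (fun t => exists2 a, ideal_of iV a & t = l a).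
  have [s' ss'] : invertible (l (tmon k E (clear_denom M b))).
    by apply: contrapT => /nonunitM; exact: clear_denom_notin.
  have -> : z b - 1 = s' * ((z b - 1) * l (tmon k E (clear_denom M b))).
    by rewrite mulrC -mulrA ss' mulr1.
  rewrite lmonom_minus1 //.
  apply/IM/mem_ideal_span; eexists; last by [].
  apply: tmon_sub_ideal; [exact/add_clear_denom_nonneg/zero_onW|exact: clear_denom_nonneg|].
  by rewrite addrK row_kerP.
move=> i iE Mi; have iG : i \in G by apply/vanishing_varsP.
have [j rj] := rowF (subsetP subGF _ iG).
exists (rshift r j); first exact: leq_addr.
have -> : y (rshift r j) = l (taffine_var k E i).
  have -> : y (rshift r j) = z (row (rshift r j) B) - 0.
    apply: ysp; rewrite /special /= ltnNge leq_addr /=.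
    by case: exists_inP => // h; case: h; exists i => //; apply/eqP.
  by rewrite subr0 rj -lmonomE ?taffine_varE //; exact: delta_nonneg.
move=> x; split; apply: ideal_span_sub; try exact: ideal_span_ideal.
  move=> _ [a ha ->].
  have [I0 ID IM] := ideal_span_ideal (fun t : O => t = l (taffine_var k E i)).
  apply: (@ideal_span_sub _ (fun x => x = taffine_var k E i)
    (fun a => ideal_span (fun t : O => t = l (taffine_var k E i)) (l a))) ha.
    split; first by rewrite rmorph0.
      by move=> u v hu hv; rewrite rmorphD; apply: ID.
    by move=> u v hv; rewrite rmorphM; apply: IM.
  by move=> _ ->; apply: mem_ideal_span.
move=> _ ->; apply: mem_ideal_span; exists (taffine_var k E i) => //.
exact: mem_ideal_span.
Qed.
End AtPoint.

Lemma subtorus_transversal :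
  Defs.transversal E (taffine_var k E) (ideal_of iV).
Proof.
by move=> M maxM VM; apply: subtorus_transversal_at => //; exact: maximal_prime.
Qed.
End SubtorusTransversal.

(** * Equations of a transversal subvariety *)

Lemma prod_denominators (R O : comNzRingType) (M : R -> Prop) (l : {rmorphism R -> O})
    (T : finType) (x : T -> O) : prime_ideal M -> is_localization_at M l ->
  exists s (a : T -> R), ~ M s /\ forall t, x t * l s = l (a t).
Proof.
move=> [_ M1 Mp] [_ lf _].
pose f t := projT1 (cid (lf (x t))).
have fP t : exists s, ~ M s /\ x t * l s = l (f t) by rewrite /f; case: cid.
pose g t := projT1 (cid (fP t)).
have gP t : ~ M (g t) /\ x t * l (g t) = l (f t) by rewrite /g; case: cid.
exists (\prod_t g t), (fun t => f t * \prod_(t' | t' != t) g t'); split.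
  elim/big_ind: _ => [//|a b na nb|t _]; first by move=> /Mp[].
  by case: (gP t).
by move=> t; rewrite (bigD1 t) //= [l (g t * _)]rmorphM mulrA (gP t).2 rmorphM.
Qed.

Lemma ideal_span_family (R : comNzRingType) (T : finType) (p : pred T) (y : T -> R) x :
  ideal_span (fun z => exists2 i, p i & z = y i) x ->
  exists c, x = \sum_(i | p i) c i * y i.
Proof.
apply: (@ideal_span_sub _ _ (fun x => exists c, x = \sum_(i | p i) c i * y i)).
  split.
  - by exists (fun=> 0); rewrite big1 // => i _; rewrite mul0r.
  - move=> _ _ [c ->] [c' ->]; exists (fun i => c i + c' i).
    by rewrite -big_split; apply: eq_bigr => i _; rewrite mulrDl.
  move=> a _ [c ->]; exists (fun i => a * c i); rewrite mulr_sumr.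
  by apply: eq_bigr => i _; rewrite mulrA.
move=> _ [i pi ->]; exists (fun j => (j == i)%:R).
rewrite (bigD1 i) //= eqxx mul1r big1 ?addr0 // => j /andP[_ /negbTE ->].
by rewrite mul0r.
Qed.

(** * The point with x_i = 0 for i in F and x_i = 1 elsewhere *)

Section TransversalPoint.
Variables (k : fieldType) (n d : nat) (E F : {set 'I_n}) (A : 'M[int]_(n, d)).
Hypothesis faceF : is_face A E F.
Local Notation W := (taffine k E).
Implicit Types (m : 'rV[int]_n) (w : W).

Let subFE i : i \in F -> i \in E.
Proof. by case: faceF => /subsetP h _; exact: h. Qed.

Definition zero_at m : bool := [forall i in F, m 0 i == 0].

Lemma zero_atP m : reflect (forall i, i \in F -> m 0 i = 0) (zero_at m).
Proof.
apply: (iffP forall_inP) => h i iF; first exact/eqP/h.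
by rewrite h.
Qed.

Lemma zero_atD a b : nonneg_on E a -> nonneg_on E b ->
  zero_at (a + b) = zero_at a && zero_at b.
Proof.
move=> ha hb; apply/zero_atP/andP => [h|[/zero_atP az /zero_atP bz] i iF].
  split; apply/zero_atP => i iF; have := h i iF; rewrite mxE;
  have := ha i (subFE iF); have := hb i (subFE iF);
  move: (a 0 i) (b 0 i) => x y; lia.
by rewrite mxE az ?bz.
Qed.

Lemma zero_at0 : zero_at 0.
Proof. by apply/zero_atP => i _; rewrite mxE. Qed.

(** On F the lattice vector b - a equals b, which is nonnegative, so the face condition makes it
    zero. Thus the value of a monomial at the point depends only on its image under [lmon A]. *)
Lemma zero_at_fiber a b : nonneg_on E a -> nonneg_on E b -> a *m A = b *m A ->
  zero_at a -> zero_at b.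
Proof.
move=> ha hb ab /zero_atP az; apply/zero_atP => i iF.
have [_ face] := faceF; have := face (b - a).
rewrite mulmxBl ab subrr => /(_ erefl) h.
have hba : forall i, i \in F -> (b - a) 0 i = b 0 i by move=> j jF; rewrite !mxE az // subr0.
rewrite -hba // h // => j jF; rewrite hba //; exact/hb/subFE.
Qed.

Let Wind (Z : zmodType) (f h : W -> Z) :=
  @taffine_addr_ext k n E Z f h.

Section LinearForms.
Variables (S : comNzRingType) (c0 : {rmorphism k -> S}) (u : 'rV[int]_n -> S).
Definition teval w : S := leval c0 u (taffine_val w).
Lemma tevalD : {morph teval : v w / v + w}.
Proof. by move=> v w; exact: levalD. Qed.
Lemma teval_mon c m : nonneg_on E m -> teval (c *: tmon k E m) = c0 c * u m.
Proof.
by move=> hm; apply: etrans (congr1 (leval c0 u) (val_tmonZ c hm)) _; exact: leval_lterm.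
Qed.
Lemma teval0 : teval 0 = 0.
Proof. exact: leval0. Qed.
Lemma tevalB : {morph teval : v w / v - w}.
Proof. by move=> v w; exact: levalB. Qed.
Lemma tevalM : (forall a b, nonneg_on E a -> nonneg_on E b -> u (a + b) = u a * u b) ->
  {morph teval : v w / v * w}.
Proof.
move=> uM [v hv] [w hw]; exact: (@levalM _ _ _ c0 u (nonneg_on E) uM v w
  (elimT (taffine_predP _ _) hv) (elimT (taffine_predP _ _) hw)).
Qed.
Lemma teval_tmon m : nonneg_on E m -> teval (tmon k E m) = u m.
Proof. by move=> hm; rewrite -[tmon k E m]scale1r teval_mon // rmorph1 mul1r. Qed.
End LinearForms.

Definition eps : W -> k := teval (GRing.RMorphism.clone _ _ idfun _) (fun m => (zero_at m)%:R).

Lemma epsM : {morph eps : v w / v * w}.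
Proof.
by apply: tevalM => a b ha hb; rewrite zero_atD //; case: zero_at; rewrite ?mul1r ?mul0r.
Qed.
Lemma epsD : {morph eps : v w / v + w}. Proof. exact: tevalD. Qed.
Lemma epsB : {morph eps : v w / v - w}. Proof. exact: tevalB. Qed.
Lemma eps0 : eps 0 = 0. Proof. exact: teval0. Qed.
Lemma eps_tmon m : nonneg_on E m -> eps (tmon k E m) = (zero_at m)%:R.
Proof. exact: teval_tmon. Qed.
Lemma eps1 : eps 1 = 1.
Proof. by rewrite -tmon0 eps_tmon ?zero_at0 //; exact: nonneg_on0. Qed.
Lemma eps_scalar c : eps (c *: 1) = c.
Proof.
rewrite -(tmon0 k E) /eps teval_mon; last exact: nonneg_on0.
by rewrite zero_at0 mulr1.
Qed.

(* The derivation at the point x_i = 0 (i in F), x_i = 1 (i not in F).       *)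
Definition dmon (j : 'I_n) m : k :=
  if j \in F then [forall i in F, m 0 i == (i == j)%:R]%:R
  else if zero_at m then (m 0 j)%:~R else 0.

Lemma dmonD j a b : nonneg_on E a -> nonneg_on E b ->
  dmon j (a + b) = (zero_at a)%:R * dmon j b + (zero_at b)%:R * dmon j a.
Proof.
move=> ha hb; rewrite /dmon; case: ifP => jF; last first.
  rewrite zero_atD //; case: (zero_at a); case: (zero_at b);
    rewrite /= ?mul0r ?mul1r ?add0r ?addr0 //.
  by rewrite mxE rmorphD addrC.
set Da := [forall i in F, a 0 i == _]; set Db := [forall i in F, b 0 i == _].
set Dab := [forall i in F, (a + b) 0 i == _].
have DP m : reflect (forall i, i \in F -> m 0 i = (i == j)%:R)
    [forall i in F, m 0 i == (i == j)%:R].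
  by apply: (iffP forall_inP) => h i iF; [exact/eqP/h|rewrite h].
have za x : zero_at x -> [forall i in F, x 0 i == (i == j)%:R] = false.
  by move=> /zero_atP xz; apply/negP => /DP/(_ j jF); rewrite xz // eqxx.
(* A sum of two vectors that are nonnegative on F is a unit vector there exactly when one summand is
   that vector and the other is zero. *)
have DabE : Dab = (zero_at a && Db) || (zero_at b && Da).
  apply/DP/orP => [h|[]/andP[/zero_atP hz /DP hD] i iF]; last first.
  - by rewrite mxE hz // hD // addr0.
  - by rewrite mxE hz // hD // add0r.
  have hh i : i \in F -> (i != j -> a 0 i = 0 /\ b 0 i = 0) /\
       (i = j -> (a 0 i = 0 /\ b 0 i = 1) \/ (a 0 i = 1 /\ b 0 i = 0)).
    move=> iF; have := h i iF; rewrite mxE; have := ha i (subFE iF); have := hb i (subFE iF).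
    case: (eqVneq i j) => ij; rewrite ?mulr1n ?mulr0n; move: (a 0 i) (b 0 i) => x y hx hy hxy.
      by split=> // _; lia.
    by split=> [_|ji]; [lia|rewrite ji eqxx in ij].
  have [_ /(_ erefl) [[aj bj]|[aj bj]]] := hh j jF; [left|right]; apply/andP; split.
  - by apply/zero_atP => i iF; have [->//|/(hh i iF).1[]] := eqVneq i j.
  - by apply/DP => i iF; have [->//|/(hh i iF).1[]] := eqVneq i j.
  - by apply/zero_atP => i iF; have [->//|/(hh i iF).1[]] := eqVneq i j.
  - by apply/DP => i iF; have [->//|/(hh i iF).1[]] := eqVneq i j.
rewrite DabE; case ea: (zero_at a); case eb: (zero_at b) => /=;
  rewrite ?mul0r ?mul1r ?add0r ?addr0 ?orbF //.
by rewrite /Da /Db !za // addr0.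
Qed.

Definition der j : W -> k := teval (GRing.RMorphism.clone _ _ idfun _) (dmon j).

Lemma derD j : {morph der j : v w / v + w}. Proof. exact: tevalD. Qed.
Lemma derB j : {morph der j : v w / v - w}. Proof. exact: tevalB. Qed.
Lemma der0 j : der j 0 = 0. Proof. exact: teval0. Qed.

Lemma derM j v w : der j (v * w) = eps v * der j w + eps w * der j v.
Proof.
move: v; apply: Wind => [v v'|v v'|c a ha].
- by rewrite mulrDl derD.
- by rewrite epsD derD; ring.
move: w; apply: Wind => [w w'|w w'|c' b hb].
- by rewrite mulrDr derD.
- by rewrite epsD derD; ring.
rewrite -scalerAl -scalerAr scalerA -tmonD // /der /eps !teval_mon //=; last exact: nonneg_onD.
by rewrite dmonD //; ring.
Qed.

Let I w : Prop := lmon A (taffine_val w) = 0.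
Let M w : Prop := eps w = 0.

Let on_point c : bool := `[< exists m, [/\ nonneg_on E m, zero_at m & m *m A = c] >].

Let on_pointE m : nonneg_on E m -> on_point (m *m A) = zero_at m.
Proof.
move=> hm; apply/asboolP/idP => [[m' [hm' zm' mm']]|zm]; last by exists m.
exact: zero_at_fiber zm'.
Qed.

(** By [zero_at_fiber], evaluation at the point factors through [lmon A]. *)
Lemma point_in_closure w : I w -> M w.
Proof.
move=> Iw; pose h : laurent k d -> k :=
  leval (GRing.RMorphism.clone _ _ idfun _) (fun c => (on_point c)%:R).
suff e v : eps v = h (lmon A (taffine_val v)).
  by rewrite /M e; apply: etrans (congr1 h Iw) _; exact: leval0.
move: v; apply: Wind => [v v'|v v'|c m hm].
- exact: epsD.
- apply: etrans (congr1 h (lmonD A (taffine_val v) (taffine_val v'))) _; exact: levalD.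
rewrite /eps teval_mon //; apply/esym.
apply: etrans (congr1 (fun p => h (lmon A p)) (val_tmonZ c hm)) _.
apply: etrans (congr1 h (lmon_lterm A c m)) _; apply: etrans (leval_lterm _ _ _ _) _.
by rewrite on_pointE.
Qed.

Lemma point_maximal : maximal_ideal M.
Proof.
have M1 : ~ M 1 by rewrite /M eps1 => /eqP; rewrite oner_eq0.
split=> //.
  split=> [|a b|c a]; rewrite /M; first exact: eps0.
    by rewrite epsD => -> ->; rewrite addr0.
  by rewrite epsM => ->; rewrite mulr0.
move=> N [N0 ND NM] MN; case: (pselect (exists2 a, N a & eps a != 0)) => [[a Na ea]|h].
  left; have -> : 1 = (eps a)^-1 *: 1 * a + (1 - (eps a)^-1 *: 1 * a) :> W.
    by rewrite addrC subrK.
  apply: ND; first exact: NM.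
  by apply: MN; rewrite /M epsB epsM eps_scalar eps1 mulVf // subrr.
by right=> a Na; apply/eqP/negbNE/negP => ea; apply: h; exists a.
Qed.

(** The part of w whose monomials vanish at the point. The rest of w is constant along the curves
    below ([curve_moving]). *)
Let moving w : W := teval (in_alg W) (fun m => if zero_at m then 0 else tmon k E m) w.

Let movingD : {morph moving : v w / v + w}. Proof. exact: tevalD. Qed.

Let moving_mon c m : nonneg_on E m ->
  moving (c *: tmon k E m) = if zero_at m then 0 else c *: tmon k E m.
Proof.
move=> hm; rewrite /moving teval_mon //; case: ifP => _; first by rewrite mulr0.
exact: mulr_algl.
Qed.

Let der_moving j w : j \notin F -> der j (moving w) = 0.
Proof.
move=> jF; move: w; apply: Wind => [v w|v w|c m hm].
- by rewrite movingD derD.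
- by rewrite addr0.
rewrite moving_mon //; case: ifP => zm; first exact: der0.
by rewrite /der teval_mon // /dmon (negbTE jF) zm mulr0.
Qed.

(** Monomials with the same image under [lmon A] are kept or dropped together, so the truncation
    comes from one on k[T^d]. *)
Let moving_ideal w : I w -> I (moving w).
Proof.
move=> Iw; pose h : laurent k d -> laurent k d :=
  leval (in_alg (laurent k d)) (fun c => if on_point c then 0 else lterm 1 c).
suff e v : lmon A (taffine_val (moving v)) = h (lmon A (taffine_val v)).
  by rewrite /I e; apply: etrans (congr1 h Iw) _; exact: leval0.
move: v; apply: Wind => [v v'|v v'|c m hm].
- apply: etrans (congr1 (fun x => lmon A (taffine_val x)) (movingD v v')) _.
  exact: lmonD.
- apply: etrans (congr1 h (lmonD A (taffine_val v) (taffine_val v'))) _; exact: levalD.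
rewrite moving_mon //; apply/esym.
apply: etrans (congr1 (fun p => h (lmon A p)) (val_tmonZ c hm)) _.
apply: etrans (congr1 h (lmon_lterm A c m)) _; apply: etrans (leval_lterm _ _ _ _) _.
rewrite on_pointE //; case: ifP => _.
  by rewrite mulr0; apply/esym/(raddf0 (lmon A)).
apply: etrans (mulr_algl _ _) _; rewrite lscaleU mulr1; apply/esym.
by apply: etrans (congr1 (lmon A) (val_tmonZ c hm)) _; rewrite lmon_lterm.
Qed.

Section Curve.
Variable wt : 'I_n -> nat.
Hypothesis wt_gt0 : forall i, (0 < wt i)%N.

Definition weight m : nat := `|\sum_(i in F) (wt i)%:Z * m 0%R i|.

Lemma weight_ge0 m : nonneg_on E m -> 0 <= \sum_(i in F) (wt i)%:Z * m 0 i.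
Proof.
by move=> hm; apply: sumr_ge0 => i iF; rewrite mulr_ge0 // hm // subFE.
Qed.

Lemma weightE m : nonneg_on E m ->
  (weight m : int) = \sum_(i in F) (wt i)%:Z * m 0 i.
Proof. by move=> hm; rewrite /weight gez0_abs // weight_ge0. Qed.

Lemma weightD a b : nonneg_on E a -> nonneg_on E b -> weight (a + b) = (weight a + weight b)%N.
Proof.
move=> ha hb; apply/eqP; rewrite -eqz_nat PoszD !weightE //; last exact: nonneg_onD.
by rewrite -big_split /=; apply/eqP/eq_bigr => i _; rewrite mxE mulrDr.
Qed.

Lemma weight_eq0 m : nonneg_on E m -> (weight m == 0%N) = zero_at m.
Proof.
move=> hm; rewrite -eqz_nat weightE // psumr_eq0 => [|i iF]; last first.
  by rewrite mulr_ge0 // hm // subFE.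
apply/allP/zero_atP => h i.
  move=> iF; have := h i (mem_index_enum i); rewrite iF /= mulf_eq0.
  by have := wt_gt0 i; case: (wt i) => // w _ /= /eqP.
by move=> _; apply/implyP => iF; rewrite h // mulr0.
Qed.

(* Restriction to the curve x_i = t^(wt i) (i in F), x_i = 1 (i not in F).    *)
Definition curve : W -> {poly k} := teval (@polyC k) (fun m => 'X^(weight m)).

Lemma curveM : {morph curve : v w / v * w}.
Proof. by apply: tevalM => a b ha hb; rewrite weightD // exprD. Qed.
Lemma curveD : {morph curve : v w / v + w}. Proof. exact: tevalD. Qed.

Lemma curve0 w : (curve w).[0] = eps w.
Proof.
move: w; apply: Wind => [v w|v w|c m hm].
- by rewrite curveD hornerD.
- exact: epsD.
rewrite /curve /eps !teval_mon //= hornerM hornerC hornerXn -weight_eq0 //.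
by case: (weight m) => [|N]; rewrite ?expr0 // exprS mul0r.
Qed.

Lemma curve_moving w : curve w = curve (moving w) + (eps w)%:P.
Proof.
move: w; apply: Wind => [v w|v w|c m hm].
- exact: curveD.
- by rewrite movingD epsD !curveD polyCD addrACA.
rewrite moving_mon //; case: ifP => zm.
  rewrite [curve 0]teval0 add0r /curve /eps !teval_mon // zm.
  by move: zm; rewrite -weight_eq0 // => /eqP ->; rewrite expr0 !mulr1.
by rewrite /eps teval_mon // zm mulr0 addr0.
Qed.
End Curve.

Let I_ideal : is_ideal I.
Proof.
split=> [|v w Iv Iw|c w Iw].
- exact: (raddf0 (lmon A)).
- apply: etrans (lmonD A _ _) _; apply: etrans (congr2 +%R Iv Iw) _; exact: addr0.
- have [_ lM] := lmon_monoid k A.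
  have e : lmon A (taffine_val (c * w)) = lmon A (taffine_val c) * lmon A (taffine_val w).
    exact: (lM (taffine_val c) (taffine_val w)).
  apply: etrans e _.
  by apply: etrans (congr1 ( *%R _) Iw) _; exact: mulr0.
Qed.

Lemma dmon_delta i j : dmon j (delta_mx 0 i) = (i == j)%:R.
Proof.
rewrite /dmon; case: ifPn => jF.
  have [ij|ij] := eqVneq i j.
    rewrite ij (_ : [forall x in F, _]) //; apply/forall_inP => x _.
    by rewrite mxE eqxx.
  rewrite (_ : [forall x in F, _] = false) //; apply/negP => /forall_inP/(_ j jF).
  by rewrite mxE !eqxx (eq_sym j i) (negbTE ij).
case: ifPn => [_|zi]; first by rewrite mxE eqxx eq_sym; case: eqP.
have [ij|//] := eqVneq i j; case/negP: zi; apply/zero_atP => x xF.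
by rewrite mxE eqxx /= ij; case: eqP xF => // ->; rewrite (negbTE jF).
Qed.

Lemma der_var i j : der j (taffine_var k E i) = (i == j)%:R.
Proof.
by rewrite taffine_varE /der teval_tmon ?dmon_delta //; exact: delta_nonneg.
Qed.

Lemma der_scalar c j : der j (c *: 1) = 0.
Proof.
have h0 : nonneg_on E 0 by exact: nonneg_on0.
have := dmonD j h0 h0.
rewrite addr0 zero_at0 mul1r => /eqP; rewrite -subr_eq0 opprD addNKr oppr_eq0 => /eqP d0.
by rewrite -(tmon0 k E) /der teval_mon // d0 mulr0.
Qed.

Section Transversal.
Hypothesis transI : Defs.transversal E (taffine_var k E) I.

Let primeM : prime_ideal M. Proof. exact/maximal_prime/point_maximal. Qed.

(** Transversality transferred from the local ring to W: the a_i are numerators of the y_i over a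
    common denominator, and the relations hold after multiplication by some s outside M. *)
Lemma transversal_point_equations : exists (r : nat) (a : 'I_n -> W),
  [/\ forall i, M (a i),
      forall w, M w -> exists s b, ~ M s /\ s * w = \sum_i b i * a i,
      forall w, I w -> exists s b, ~ M s /\ s * w = \sum_(i < n | (i < r)%N) b i * a i,
      forall i : 'I_n, (i < r)%N -> exists s, ~ M s /\ I (s * a i) &
      forall i, i \in F -> exists (j : 'I_n) s b,
        [/\ (r <= j)%N, ~ M s & s * taffine_var k E i = b * a j]].
Proof.
have [O [l [locM [y [r [rn ysys yI yE]]]]]] := transI point_maximal point_in_closure.
have [[M0 MD MM] M1 Mp] := primeM; have [I0 ID IM] := I_ideal.
have nonunit := localization_nonunit primeM locM.
have l_inj : injective l.
  move=> u v uv; apply/eqP; rewrite -subr_eq0; apply/eqP.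
  have [_ _ /(_ (u - v))[|s [ns suv]]] := locM.
    by rewrite rmorphB uv subrr.
  have := congr1 (@taffine_val k n E) suv; rewrite rmorphM rmorph0.
  case/laurent_integral => [s0|uv0]; last by apply: val_inj.
  by case: ns; rewrite (_ : s = 0) //; apply: val_inj.
have [t [a [nt ya]]] := prod_denominators y primeM locM.
have clear (p : pred 'I_n) w : ideal_span (fun z => exists2 i, p i & z = y i) (l w) ->
    exists s b, ~ M s /\ s * w = \sum_(i | p i) b i * a i.
  move=> /ideal_span_family[c cE]; have [s [b [ns cb]]] := prod_denominators c primeM locM.
  exists (s * t), b; split; first by move=> /Mp[].
  apply: l_inj; rewrite !rmorphM cE mulr_sumr rmorph_sum; apply: eq_bigr => i _.
  by rewrite rmorphM -cb -ya mulrACA [l s * _]mulrC [l t * _]mulrC.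
exists r, a; split.
- move=> i; apply/nonunit; rewrite -ya => /invertible_mull.
  by apply/(ysys _).1/mem_ideal_span; exists i.
- move=> w /nonunit/(ysys _).2 lw.
  have [|s [b [ns sw]]] := clear predT w; last by exists s, b.
  apply: ideal_span_sub lw; first exact: ideal_span_ideal.
  by move=> _ [i ->]; apply: mem_ideal_span; exists i.
- move=> w Iw; apply: clear; apply/yI; by apply: mem_ideal_span; exists w.
- move=> i ir.
  pose K x := exists s g, [/\ ~ M s, I g & x * l s = l g].
  have [s [g [ns Ig sg]]] : K (y i).
    have : localized_ideal l I (y i) by apply/yI/mem_ideal_span; exists i.
    apply: ideal_span_sub; last by move=> _ [g Ig ->]; exists 1, g; rewrite rmorph1 mulr1.
    split.
    + by exists 1, 0; rewrite rmorph0 mul0r.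
    + move=> x x' [s [g [ns Ig xs]]] [s' [g' [ns' Ig' xs']]].
      exists (s * s'), (s' * g + s * g'); split; first by move=> /Mp[].
        by apply: ID; apply: IM.
      by rewrite rmorphD !rmorphM -xs -xs'; ring.
    move=> c x [s [g [ns Ig xs]]]; have [_ frac _] := locM.
    have [b [s' [ns' cs]]] := frac c; exists (s * s'), (b * g); split.
    + by move=> /Mp[].
    + exact: IM.
    by rewrite !rmorphM -xs -cs; ring.
  have e : s * a i = t * g.
    apply: l_inj; rewrite [LHS]rmorphM [RHS]rmorphM -ya -sg; ring.
  exists s; split; first exact: ns.
  rewrite e; exact: (IM t g Ig).
move=> i iF; have Mi : M (taffine_var k E i).
  rewrite /M taffine_varE eps_tmon; last exact: delta_nonneg.
  case: zero_atP => // /(_ i iF); rewrite mxE !eqxx => /eqP.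
  by rewrite oner_eq0.
have [j rj jE] := yE i (subFE iF) Mi.
have [|s [b [ns sw]]] := clear (pred1 j) (taffine_var k E i).
  have : localized_ideal l (ideal_span (fun x => x = taffine_var k E i)) (l (taffine_var k E i)).
    by apply: mem_ideal_span; exists (taffine_var k E i) => //; exact: mem_ideal_span.
  move=> /jE; apply: ideal_span_sub; first exact: ideal_span_ideal.
  by move=> _ ->; apply: mem_ideal_span; exists j => //=.
by exists j, s, (b j); split=> //; rewrite sw big_pred1_eq.
Qed.

Let der_sum (p : pred 'I_n) (b a : 'I_n -> W) j : (forall i, M (a i)) ->
  der j (\sum_(i | p i) b i * a i) = \sum_(i | p i) eps (b i) * der j (a i).
Proof.
move=> Ma; apply: (big_ind2 (fun x y => der j x = y)) => [|x x' y y' <- <-|i _].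
- exact: der0.
- exact: derD.
by rewrite derM Ma mul0r addr0.
Qed.

Let gradient w : 'rV[k]_n := \row_j der j w.

Let gradient_mul s w : M w -> gradient (s * w) = eps s *: gradient w.
Proof. by move=> Mw; apply/rowP => j; rewrite !mxE derM Mw mul0r addr0. Qed.

(** The gradient of the moving part lies in the span of the unit vectors of F, that is, of gradients
    of parameters a_j with j >= r. The gradients of all a_i are independent, so the coefficients of
    the equations of the subvariety vanish at the point. *)
Lemma transversal_moving : exists (r : nat) (a : 'I_n -> W),
  (forall i : 'I_n, (i < r)%N -> exists s, ~ M s /\ I (s * a i)) /\
  (forall w, I w -> exists s b, [/\ ~ M s, forall i : 'I_n, (i < r)%N -> M (b i) &
     s * moving w = \sum_(i < n | (i < r)%N) b i * a i]).
Proof.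
have [r [a [Ma genM genI aI aF]]] := transversal_point_equations.
exists r, a; split=> // w Iw.
have [s [b [ns sb]]] := genI _ (moving_ideal Iw).
exists s, b; split=> // j0 j0r.
pose Da : 'M[k]_n := \matrix_i gradient (a i).
have sumE (p : pred 'I_n) (c : 'I_n -> W) :
    gradient (\sum_(i | p i) c i * a i) = (\row_i (if p i then eps (c i) else 0)) *m Da.
  apply/rowP => j; rewrite !mxE der_sum // big_mkcond /=; apply: eq_bigr => i _.
  by rewrite !mxE; case: ifP; rewrite ?mul0r.
have gradV i : gradient (taffine_var k E i) = delta_mx 0 i.
  by apply/rowP => j; rewrite !mxE der_var eqxx eq_sym.
(* The functions x_i minus their values at the point lie in M and have the standard basis as
   gradients, so the gradients of the n parameters span and Da is invertible. *)
have span i : exists v : 'rV_n, v *m Da = delta_mx 0 i.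
  pose u := taffine_var k E i - eps (taffine_var k E i) *: 1.
  have Mu : M u by rewrite /M epsB eps_scalar subrr.
  have [s' [b' [ns' sb']]] := genM u Mu; move/eqP: ns' => ns'.
  exists ((eps s')^-1 *: \row_i eps (b' i)).
  have := sumE predT b'; rewrite -sb' gradient_mul // -scalemxAl => <-.
  rewrite scalerA mulVf // scale1r -gradV.
  by apply/rowP => j; rewrite !mxE derB der_scalar subr0.
have Da_inj (v v' : 'rV_n) : v *m Da = v' *m Da -> v = v'.
  pose f i := projT1 (cid (span i)).
  have fP i : f i *m Da = delta_mx 0 i by rewrite /f; case: cid.
  have /mulmx1C Dai : (\matrix_i f i) *m Da = 1%:M.
    by apply/row_matrixP => i; rewrite row_mul rowK fP row1.
  by move=> /(congr1 (mulmx^~ (\matrix_i f i))); rewrite -!mulmxA Dai !mulmx1.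
have spanF i : i \in F -> exists v : 'rV_n, v *m Da = delta_mx 0 i /\
    forall j : 'I_n, (j < r)%N -> v 0 j = 0.
  move=> iF; have [j [s' [b' [rj /eqP ns' sb']]]] := aF i iF.
  have Mi : M (taffine_var k E i).
    have : eps (s' * taffine_var k E i) = 0 by rewrite sb' epsM Ma mulr0.
    by rewrite epsM => /eqP; rewrite mulf_eq0 (negbTE ns') => /eqP.
  exists ((eps s')^-1 *: \row_i' (if i' == j then eps b' else 0)); split.
    have := sumE (pred1 j) (fun=> b'); rewrite big_pred1_eq -sb' gradient_mul //.
    by rewrite gradV -scalemxAl => <-; rewrite scalerA mulVf // scale1r.
  move=> j' j'r; rewrite !mxE; case: eqP => [jj'|_]; last by rewrite mulr0.
  by rewrite jj' ltnNge rj in j'r.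
pose g i : 'rV_n := if pselect (i \in F) is left iF then projT1 (cid (spanF i iF)) else 0.
have gP i : i \in F -> g i *m Da = delta_mx 0 i /\ forall j : 'I_n, (j < r)%N -> g i 0 j = 0.
  by move=> iF; rewrite /g; case: pselect => // iF'; case: cid.
have Mmov : M (moving w) by exact/point_in_closure/moving_ideal.
(* Multiplied by Da, both sides are the gradient of [s * moving w]. *)
have e : \row_i (if (i < r)%N then eps (b i) else 0)
    = eps s *: \sum_(i in F) der i (moving w) *: g i.
  apply: Da_inj; rewrite -sumE -sb gradient_mul // -scalemxAl; congr (_ *: _).
  rewrite mulmx_suml (eq_bigr (fun i => der i (moving w) *: delta_mx 0 i)) => [|i iF].
    rewrite [LHS]row_sum_delta (bigID (mem F)) /= [X in _ + X]big1 ?addr0.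
      by apply: eq_bigr => i _; rewrite mxE.
    by move=> i iF; rewrite mxE der_moving // scale0r.
  by rewrite -scalemxAl (gP i iF).1.
have := congr1 (fun x : 'rV_n => x 0 j0) e; rewrite !mxE j0r /M => ->.
rewrite summxE big1 ?mulr0 // => i iF.
by rewrite mxE (gP i iF).2 ?mulr0.
Qed.

(** Induction on the order of vanishing: if t^N divides all equations on the curve, then in
    [transversal_moving] each b_i gives one more factor t and each a_i gives t^N, while s is prime
    to t. *)
Lemma curve_ideal (wt : 'I_n -> nat) w : (forall i, (0 < wt i)%N) -> I w -> curve wt w = 0.
Proof.
move=> wt0 Iw; have [r [a [aI genI]]] := transversal_moving.
have curve_coprime s N : ~ M s -> coprimep ('X^N) (curve wt s).
  move=> /eqP ns; apply: coprimep_expl; rewrite coprimep_sym -[X in coprimep _ X]subr0.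
  by rewrite coprimep_XsubC /root curve0.
suff H : forall N v, I v -> 'X^N %| curve wt v.
  apply/eqP; apply: contraTT (H (size (curve wt w)) _ Iw) => c0.
  by apply/negP => /(dvdp_leq c0); rewrite size_polyXn ltnn.
elim=> [|N IHN] v Iv; first by rewrite expr0 dvd1p.
have [s [b [ns bM sb]]] := genI v Iv.
rewrite curve_moving // (point_in_closure Iv) polyC0 addr0.
rewrite -(Gauss_dvdpr _ (curve_coprime s N.+1 ns)) -curveM sb.
have curve_sum : curve wt (\sum_(i < n | (i < r)%N) b i * a i)
    = \sum_(i < n | (i < r)%N) curve wt (b i * a i).
  apply: (big_morph (curve wt)); [exact: curveD|exact: teval0].
rewrite curve_sum; elim/big_ind: _ => [|p q hp hq|i ir]; first exact: dvdp0.
  by rewrite dvdp_add.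
rewrite curveM exprS; apply: dvdp_mul.
  have := dvdp_XsubCl (curve wt (b i)) 0; rewrite subr0 => ->.
  by rewrite /root curve0 // bM.
have [s' [ns' Is']] := aI i ir.
by have := IHN _ Is'; rewrite curveM Gauss_dvdpr // curve_coprime.
Qed.

(** On each curve the two monomials of x^(a+) - x^(a-) must have the same order, so every positive
    weight on F annihilates a. *)
Lemma transversal_vanish (a : 'rV[int]_n) : a *m A = 0 -> forall i, i \in F -> a 0 i = 0.
Proof.
move=> aA i0 i0F; set u := pos_part a; set v := pos_part (- a).
have hu : nonneg_on E u by exact: pos_part_nonneg.
have hv : nonneg_on E v by exact: pos_part_nonneg.
have uv : u - v = a by exact: pos_partB.
have Iuv : I (tmon k E u - tmon k E v) by exact: lmon_pos_part.
have weighted wt : (forall i, (0 < wt i)%N) -> \sum_(i in F) (wt i)%:Z * a 0 i = 0.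
  move=> wt0; have := curve_ideal wt0 Iuv; rewrite /curve tevalB !teval_tmon //.
  move=> /eqP; rewrite subr_eq0 => /eqP XX.
  have wuv : weight wt u = weight wt v.
    by have := congr1 (fun p : {poly k} => size p) XX; rewrite /= !size_polyXn => -[].
  apply/eqP; rewrite -uv (eq_bigr (fun i => (wt i)%:Z * u 0 i - (wt i)%:Z * v 0 i)).
    by rewrite sumrB -!weightE // wuv subrr.
  by move=> i _; rewrite mxE [(- v) 0 i]mxE mulrBr.
(* These weights differ by 1 at i0 only, and their difference isolates the coordinate at i0. *)
have e1 := weighted (fun=> 1%N) (fun=> isT).
have e2 := weighted (fun i => if i == i0 then 2%N else 1%N).
have : \sum_(i in F) (if i == i0 then 2%N else 1%N)%:Z * a 0 i
     = a 0 i0 + \sum_(i in F) 1%:Z * a 0 i.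
  rewrite (bigD1 i0) //= eqxx [in RHS](bigD1 i0) //= addrA; congr (_ + _); first by lia.
  by apply: eq_bigr => i /andP[_ /negbTE ->].
rewrite e1 e2 ?addr0 // => i; by case: ifP.
Qed.
End Transversal.
End TransversalPoint.

(** * Minimality *)

Section Comparison.
Variables (k : fieldType) (n : nat) (E : {set 'I_n}).
Local Notation W := (taffine k E).

Lemma toric_in_TA_lmon (V : toric_variety k) (iV : {lrmorphism W -> V}) :
  toric_in_TA iV -> exists A : 'M[int]_(n, torus_dim V),
    (forall w, lmon A (taffine_val w) = torus_incl V (iV w)) /\
    (forall w, ideal_of iV w <-> lmon A (taffine_val w) = 0).
Proof.
case=> _ [phi [phiE /torus_hom_lmon[A phiA]]]; exists A.
have e w : lmon A (taffine_val w) = torus_incl V (iV w).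
  by rewrite -(phiA (taffine_val w)); exact: phiE.
split=> // w; split=> [w0|]; last by rewrite e; exact: torus_incl_eq0.
by apply: etrans (e w) _; rewrite w0; exact: (raddf0 (torus_incl V)).
Qed.

(** It suffices to test the binomial x^(a+) - x^(a-). *)
Lemma exponent_kernel_sub d d' (A : 'M[int]_(n, d)) (A' : 'M[int]_(n, d')) :
  (forall w : W, lmon A' (taffine_val w) = 0 -> lmon A (taffine_val w) = 0) ->
  forall a : 'rV_n, a *m A' = 0 -> a *m A = 0.
Proof.
move=> sub a aA'; have := sub _ (lmon_pos_part k E aA').
rewrite lmon_tmonB; [|exact: pos_part_nonneg..] => /eqP.
rewrite subr_eq0 => /eqP/lterm1_inj uv.
by rewrite -[a]pos_partB mulmxBl uv subrr.
Qed.

(** By the inclusion of lattices mA is a function of mA', so [lmon A] factors through [lmon A']. *)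
Lemma lmon_kernel_sub d d' (A : 'M[int]_(n, d)) (A' : 'M[int]_(n, d')) :
  (forall a : 'rV_n, a *m A' = 0 -> a *m A = 0) ->
  forall p : laurent k n, lmon A' p = 0 -> lmon A p = 0.
Proof.
move=> sub p p0.
pose h c : 'rV_d := if pselect (exists m : 'rV_n, m *m A' = c) is left e
  then projT1 (cid e) *m A else 0.
have hE m : h (m *m A') = m *m A.
  rewrite /h; case: pselect => [e|[]]; last by exists m.
  case: cid => m' /= mm'; apply/eqP; rewrite -subr_eq0 -mulmxBl.
  by apply/eqP/sub; rewrite mulmxBl mm' subrr.
pose g : laurent k d' -> laurent k d :=
  leval (in_alg (laurent k d)) (fun c => lterm 1 (h c)).
suff e q : lmon A q = g (lmon A' q).
  by rewrite e; apply: etrans (congr1 g p0) _; exact: leval0.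
move: q; apply: (@laurent_addr_ext k n _ (lmon A)).
- exact: lmonD.
- move=> q q'; apply: etrans (congr1 g (lmonD A' q q')) _; exact: levalD.
move=> c m; rewrite lmon_lterm; apply/esym.
apply: etrans (congr1 g (lmon_lterm A' c m)) _; apply: etrans (leval_lterm _ _ _ _) _.
by apply: etrans (mulr_algl _ _) _; rewrite lscaleU mulr1 hE.
Qed.
End Comparison.

Lemma is_face_sub n d d' (A : 'M[int]_(n, d)) (A' : 'M[int]_(n, d')) E F :
  (forall a : 'rV_n, a *m A' = 0 -> a *m A = 0) -> is_face A E F -> is_face A' E F.
Proof. by move=> sub [FE h]; split=> // a /sub; exact: h. Qed.

(* Closed subschemes of W are equal when their ideals are. *)
Theorem theorem3p10 (k : fieldType) (kperf : perfect_field k)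
    (n : nat) (E : {set 'I_n})
    (X : toric_variety k) (iX : {lrmorphism taffine k E -> X})
    (hX : toric_in_TA iX) :
  (exists (V : toric_variety k) (iV : {lrmorphism taffine k E -> V}),
     minimum_transversal iX iV) /\
  (forall (V1 V2 : toric_variety k)
          (i1 : {lrmorphism taffine k E -> V1})
          (i2 : {lrmorphism taffine k E -> V2}),
     minimum_transversal iX i1 -> minimum_transversal iX i2 ->
     same_ideal (ideal_of i1) (ideal_of i2)).
Proof.
split; last first.
  move=> V1 V2 i1 i2 [b1 t1 min1] [b2 t2 min2] w.
  by split; [apply: min2|apply: min1].
have [AX [iXE kerX]] := toric_in_TA_lmon hX.
have [F [faceF maxF]] := maximum_face AX E.
have [r [rho [B [C [n_eq BC CB kerP [rowF rowB]]]]]] := adapted_basis AX F.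
subst n.
have QP : dsubmx B *m rsubmx C = 1%:M.
  have := BC; rewrite -{1}[B]vsubmxK -{1}[C]hsubmxK mul_col_row scalar_mx_block.
  by move=> /eq_block_mx[].
have kerPX (a : 'rV_(r + rho)) : a *m rsubmx C = 0 -> a *m AX = 0 by move=> /kerP[].
have kerPF (a : 'rV_(r + rho)) : a *m rsubmx C = 0 -> forall i, i \in F -> a 0 i = 0.
  by move=> /kerP[].
exists (subtorus_variety_of k E QP), (subtorus_proj k E (rsubmx C)).
have [iX_surj _] := hX; split.
- exact: subtorus_between.
- apply: subtorus_transversal BC CB kerPF rowF rowB _ => G [GE faceG].
  (* If a in L_X is nonnegative on the union of G and F, it vanishes on F as F is a face of X; so it
     lies in the lattice of V, of which G is a face. *)
  suff /maxF : is_face AX E (G :|: F) by rewrite subUset => /andP[].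
  have [FE fF] := faceF; split; first by rewrite subUset GE FE.
  move=> a aX a0 i.
  have aF : forall i, i \in F -> a 0 i = 0.
    by apply: fF => // j jF; apply: a0; rewrite inE jF orbT.
  rewrite inE => /orP[|/aF//]; apply: faceG => [|j jG]; first exact/kerP.
  by apply: a0; rewrite inE jG.
move=> V' iV' [inV' [f [fE _]]] trV' w; have [A' [iV'E kerV']] := toric_in_TA_lmon inV'.
have subX (a : 'rV_(r + rho)) : a *m A' = 0 -> a *m AX = 0.
  apply: (@exponent_kernel_sub k (r + rho) E) => v /kerV' v0; apply/kerX.
  by apply: etrans (esym (fE v)) _; rewrite v0; exact: (raddf0 f).
(* The lattice of V' is contained in that of X, so F is a face of V' as well. *)
have face' := is_face_sub subX faceF.
have trI : Defs.transversal E (taffine_var k E) (fun w => lmon A' (taffine_val w) = 0).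
  rewrite (_ : (fun w => _) = ideal_of iV') //.
  by apply/funext => v; apply/propext; split=> /kerV'.
move=> /kerV' w0; apply/subtorus_proj_ker; apply: lmon_kernel_sub w0 => a aA'.
apply/kerP; split; first exact: subX.
exact: (transversal_vanish face' trI aA').
Qed.
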